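(* Let $R$ be a commutative Noetherian ring with unity in which $2$ is invertible, and let $I$ be an ideal of $R$. Let $Q$ be a quadratic $R$-space of rank $n\ge 1$, let $P$ be a finitely generated projective $R$-module of rank $m\ge 2$, and let $M=Q\perp\mathbb{H}(P)$. Let $\alpha(X)\in\mathrm{O}_{R[X]}(M[X])$ with $\alpha(0)=\mathrm{Id}$. If for every maximal ideal $\mathfrak m$ of $R$ we have $$\alpha_{\mathfrak m}(X)\in\mathrm{EO}_{(R_{\mathfrak m}[X],I_{\mathfrak m}[X])}(Q_{\mathfrak m}[X],\mathbb{H}(P_{\mathfrak m}[X])),$$ then $\alpha(X)\in\mathrm{EO}_{(R[X],I[X])}(Q[X],\mathbb{H}(P[X]))$.
   Context: Let $A$ be a commutative ring in which $2$ is invertible. A quadratic form $q$ on an $A$-module $M$ satisfies $q(rx)=r^2q(x)$ and $\langle x,y\rangle_q:=q(x+y)-q(x)-q(y)$ is bilinear. A quadratic $A$-space is a finitely generated projective $A$-module $Q$ with a non-degenerate quadratic form $q$, meaning that $d_{\langle\,,\rangle_q}:Q\to Q^*=\mathrm{Hom}_A(Q,A)$, $z\mapsto\langle z,-\rangle_q$, is an isomorphism. For a finitely generated projective $A$-module $P$, $\mathbb{H}(P)=P\oplus P^*$ with the hyperbolic quadratic form $(x,f)\mapsto f(x)$; $\perp$ denotes orthogonal sum. $\mathrm{O}_A(M)$ is the group of $A$-linear automorphisms of a quadratic space $M$ preserving the bilinear form. DSER elementary orthogonal group: let $M=Q\perp\mathbb{H}(P)$. For $A$-linear $\alpha:Q\to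 P$ let $\alpha^*:P^*\to Q$ be determined by $\langle\alpha^*(f),z\rangle_q=f(\alpha(z))$, and put $$E_\alpha(z,x,f)=\bigl(z-\alpha^*(f),\;x+\alpha(z)-\tfrac12\alpha\alpha^*(f),\;f\bigr).$$ For $A$-linear $\beta:Q\to P^*$ let $\beta^*:P\to Q$ be determined by $\langle\beta^*(x),z\rangle_q=\beta(z)(x)$, and put $$E^*_\beta(z,x,f)=\bigl(z-\beta^*(x),\;x,\;\beta(z)-\tfrac12\beta\beta^*(x)+f\bigr).$$ $\mathrm{EO}_A(Q,\mathbb{H}(P))$ is the subgroup of $\mathrm{O}_A(M)$ generated by all $E_\alpha,E^*_\beta$. For an ideal $J$ of $A$, $\mathrm{EO}_J(Q,\mathbb{H}(P))$ is generated by those with $\alpha:Q\to JP$, $\beta:Q\to JP^*$, and $\mathrm{EO}_{(A,J)}(Q,\mathbb{H}(P))$ is the normal closure of $\mathrm{EO}_J(Q,\mathbb{H}(P))$ in $\mathrm{EO}_A(Q,\mathbb{H}(P))$. For an $R$-module $N$, $N[X]=N\otimes_R R[X]$ (with extended form if quadratic); $I[X]$ is the ideal of $R[X]$ generated by $I$; the subscript $\mathfrak m$ denotes localization at $\mathfrak m$ (base change to $R_{\mathfrak m}$). *)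

(* Defs.v *)
From HB Require Import structures.
From mathcomp Require Import all_boot all_order all_algebra.
From mathcomp Require Import generic_quotient ring.
From mathcomp Require Import boolp classical_sets.

Set Implicit Arguments.
Unset Strict Implicit.
Unset Printing Implicit Defensive.

Import GRing.Theory.
Local Open Scope ring_scope.
Local Open Scope quotient_scope.

Section Submodules.
Variables (A : comNzRingType) (N : lmodType A).

Definition submod_span (S : set N) : set N :=
  fun x => exists l : seq (A * N),
    (forall c, c \in l -> S c.2) /\ x = \sum_(c <- l) c.1 *: c.2.

Definition finitely_generated : Prop :=
  exists s : seq N, forall x, submod_span (fun y => y \in s) x.

Definition projective : Prop :=
  forall (U V : lmodType A) (g : {linear U -> V}) (f : {linear N -> V}),
    (forall v, exists u, g u = v) ->
    exists h : {linear N -> U}, forall x, g (h x) = f x.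

Definition ideal_mul (J : set A) : set N :=
  submod_span (fun y => exists a x, J a /\ y = a *: x).

Lemma ideal_mulT x : ideal_mul setT x.
Proof.
exists [:: (1, x)]; rewrite big_seq1 scale1r; split=> // c.
by rewrite inE => /eqP ->; exists 1, x; rewrite scale1r.
Qed.

End Submodules.

Arguments finitely_generated {A} N.
Arguments projective {A} N.
Arguments ideal_mul {A} N J.

Definition is_ideal (A : comNzRingType) (I : set A) : Prop :=
  [/\ I 0, forall x y, I x -> I y -> I (x + y) & forall a x, I x -> I (a * x)].

Definition noetherian (A : comNzRingType) : Prop :=
  forall I : set A, is_ideal I ->
    exists s : seq A, forall x, I x <-> submod_span (N := A^o) (fun y => y \in s) x.

(* The ideal of B generated by the image of I: I[X] for phi = polyC, I_p for
   phi = toloc p. *)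
Definition extIdeal (A B : comNzRingType) (phi : A -> B) (I : set A) : set B :=
  submod_span (N := B^o) (fun y => exists2 x, I x & y = phi x).

Definition is_prime_ideal (A : comNzRingType) (p : set A) : Prop :=
  [/\ is_ideal p, ~ p 1 & forall x y, p (x * y) -> p x \/ p y].

Definition is_maximal_ideal (A : comNzRingType) (m : set A) : Prop :=
  [/\ is_ideal m, ~ m 1 &
   forall J : set A, is_ideal J -> ~ J 1 -> (forall x, m x -> J x) -> J = m].

Record primeIdeal (A : comNzRingType) := PrimeIdeal {
  prime_set :> A -> Prop;
  prime_setP : is_prime_ideal prime_set }.

Lemma maximal_prime (A : comNzRingType) (m : set A) :
  is_maximal_ideal m -> is_prime_ideal m.
Proof.
case=> mI m1 mmax; split=> // x y mxy.
have [mx|nmx] := pselect (m x); [by left | right].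
have [m0 mD mM] := mI.
pose J : set A := fun z => exists a b, m a /\ z = a + b * x.
have JI : is_ideal J.
  split.
  - by exists 0, 0; rewrite mul0r addr0.
  - move=> _ _ [a [b [ma ->]]] [c [d [mc ->]]].
    exists (a + c), (b + d); split; first exact: mD.
    by rewrite mulrDl addrACA.
  - move=> c _ [a [b [ma ->]]]; exists (c * a), (c * b); split; first exact: mM.
    by rewrite mulrDr mulrA.
have [[a [b [ma e1]]]|nJ1] := pselect (J 1).
  rewrite -[y]mul1r e1 mulrDl -mulrA; apply: mD; last exact: mM.
  by rewrite mulrC; apply: mM.
case: nmx; rewrite -(mmax J JI nJ1); first by exists 0, 1; rewrite add0r mul1r.
by move=> z mz; exists z, 0; rewrite mul0r addr0.
Qed.

Section Localization.
Variables (A : comNzRingType) (p : primeIdeal A).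

Definition denom := {s : A | `[< ~ p s >]}.

Definition dval (s : denom) : A := sval s.

Lemma denomP (s : denom) : ~ p (dval s).
Proof. exact/asboolP/(svalP s). Qed.

Lemma denom1P : `[< ~ p 1 >].
Proof. by apply/asboolP; case: (prime_setP p). Qed.

Lemma denomMP (s t : denom) : `[< ~ p (dval s * dval t) >].
Proof.
apply/asboolP; case: (prime_setP p) => _ _ pM /pM.
by case=> [/denomP|/(denomP)].
Qed.

Definition denom1 : denom := exist _ 1 denom1P.
Lemma dval1 : dval denom1 = 1. Proof. by []. Qed.
Definition denomM (s t : denom) : denom := exist _ (dval s * dval t) (denomMP s t).

Definition locfrac := (A * denom)%type.

Definition loceq_prop (x y : locfrac) : Prop :=
  exists u : denom, dval u * (x.1 * dval y.2) = dval u * (y.1 * dval x.2).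
Definition loceq (x y : locfrac) : bool := `[< loceq_prop x y >].

Lemma loceq_refl : reflexive loceq.
Proof. by move=> x; apply/asboolP; exists denom1. Qed.

Lemma loceq_sym : symmetric loceq.
Proof. by move=> x y; apply/asboolP/asboolP => -[u e]; exists u. Qed.

Lemma loceq_trans : transitive loceq.
Proof.
move=> y x z /asboolP[u e] /asboolP[v e']; apply/asboolP.
exists (denomM (denomM u v) y.2) => /=.
transitivity (dval v * dval z.2 * (dval u * (x.1 * dval y.2))); first by ring.
rewrite e; transitivity (dval u * dval x.2 * (dval v * (y.1 * dval z.2))); first by ring.
by rewrite e'; ring.
Qed.

Canonical loceq_equiv := EquivRel loceq loceq_refl loceq_sym loceq_trans.

Definition localized := {eq_quot loceq}.
HB.instance Definition _ : EqQuotient _ loceq localized := EqQuotient.on localized.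
HB.instance Definition _ := Choice.on localized.

Lemma loc_eqP (x y : locfrac) : (\pi_localized x = \pi_localized y) <-> loceq_prop x y.
Proof. by split=> [/eqmodP/asboolP|h] //; apply/eqmodP/asboolP. Qed.

Lemma loc_reprP (x : locfrac) : loceq_prop (repr (\pi_localized x)) x.
Proof. by apply/loc_eqP; rewrite reprK. Qed.

Definition loc_add (a b : localized) : localized :=
  let x := repr a in let y := repr b in
  \pi_localized (x.1 * dval y.2 + y.1 * dval x.2, denomM x.2 y.2).
Definition loc_opp (a : localized) : localized :=
  let x := repr a in \pi_localized (- x.1, x.2).
Definition loc_mul (a b : localized) : localized :=
  let x := repr a in let y := repr b in \pi_localized (x.1 * y.1, denomM x.2 y.2).

Lemma loc_addE (x y : locfrac) : loc_add (\pi_localized x) (\pi_localized y) =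
  \pi_localized (x.1 * dval y.2 + y.1 * dval x.2, denomM x.2 y.2).
Proof.
have [u e] := loc_reprP x; have [v e'] := loc_reprP y.
apply/loc_eqP; exists (denomM u v) => /=.
set x' := repr _ in e *; set y' := repr _ in e' *.
transitivity (dval v * dval y.2 * dval y'.2 * (dval u * (x'.1 * dval x.2)) +
  dval u * dval x.2 * dval x'.2 * (dval v * (y'.1 * dval y.2))); first by ring.
by rewrite e e'; ring.
Qed.

Lemma loc_oppE (x : locfrac) : loc_opp (\pi_localized x) = \pi_localized (- x.1, x.2).
Proof.
have [u e] := loc_reprP x; apply/loc_eqP; exists u => /=.
by rewrite !mulNr !mulrN e.
Qed.

Lemma loc_mulE (x y : locfrac) : loc_mul (\pi_localized x) (\pi_localized y) =
  \pi_localized (x.1 * y.1, denomM x.2 y.2).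
Proof.
have [u e] := loc_reprP x; have [v e'] := loc_reprP y.
apply/loc_eqP; exists (denomM u v) => /=.
set x' := repr _ in e *; set y' := repr _ in e' *.
transitivity ((dval u * (x'.1 * dval x.2)) * (dval v * (y'.1 * dval y.2)));
  first by ring.
by rewrite e e'; ring.
Qed.

Definition toloc (x : A) : localized := \pi_localized (x, denom1).

Lemma loc_addA : associative loc_add.
Proof.
elim/quotW=> x; elim/quotW=> y; elim/quotW=> z.
rewrite (loc_addE x y) (loc_addE y z) !loc_addE.
by apply/loc_eqP; exists denom1; rewrite /= ?dval1; ring.
Qed.
Lemma loc_addC : commutative loc_add.
Proof.
elim/quotW=> x; elim/quotW=> y; rewrite !loc_addE.
by apply/loc_eqP; exists denom1; rewrite /= ?dval1; ring.
Qed.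
Lemma loc_add0 : left_id (toloc 0) loc_add.
Proof.
elim/quotW=> x; rewrite loc_addE.
by apply/loc_eqP; exists denom1; rewrite /= ?dval1; ring.
Qed.
Lemma loc_addN : left_inverse (toloc 0) loc_opp loc_add.
Proof.
elim/quotW=> x; rewrite loc_oppE loc_addE.
by apply/loc_eqP; exists denom1; rewrite /= ?dval1; ring.
Qed.

HB.instance Definition _ :=
  GRing.isZmodule.Build localized loc_addA loc_addC loc_add0 loc_addN.

Lemma loc_mulA : associative loc_mul.
Proof.
elim/quotW=> x; elim/quotW=> y; elim/quotW=> z.
rewrite (loc_mulE x y) (loc_mulE y z) !loc_mulE.
by apply/loc_eqP; exists denom1; rewrite /= ?dval1; ring.
Qed.
Lemma loc_mulC : commutative loc_mul.
Proof.
elim/quotW=> x; elim/quotW=> y; rewrite !loc_mulE.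
by apply/loc_eqP; exists denom1; rewrite /= ?dval1; ring.
Qed.
Lemma loc_mul1 : left_id (toloc 1) loc_mul.
Proof.
elim/quotW=> x; rewrite loc_mulE.
by apply/loc_eqP; exists denom1; rewrite /= ?dval1; ring.
Qed.
Lemma loc_mulD : left_distributive loc_mul loc_add.
Proof.
elim/quotW=> x; elim/quotW=> y; elim/quotW=> z.
rewrite (loc_addE x y) (loc_mulE x z) (loc_mulE y z) loc_mulE loc_addE.
by apply/loc_eqP; exists denom1; rewrite /= ?dval1; ring.
Qed.
Lemma loc_1neq0 : toloc 1 != toloc 0.
Proof.
apply/eqP => /loc_eqP [u] /=; rewrite !mulr1 mulr0 => u0.
by have := @denomP u; rewrite u0; case: (prime_setP p) => -[].
Qed.

HB.instance Definition _ := GRing.Zmodule_isComNzRing.Build localized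
  loc_mulA loc_mulC loc_mul1 loc_mulD loc_1neq0.

Lemma toloc_is_zmod_morphism : zmod_morphism toloc.
Proof.
move=> x y.
rewrite -[RHS]/(loc_add (toloc x) (loc_opp (toloc y))) loc_oppE loc_addE.
by apply/loc_eqP; exists denom1; rewrite /= ?dval1; ring.
Qed.
HB.instance Definition _ :=
  GRing.isZmodMorphism.Build A localized toloc toloc_is_zmod_morphism.

Lemma toloc_is_monoid_morphism : monoid_morphism toloc.
Proof.
split=> // x y; rewrite -[RHS]/(loc_mul (toloc x) (toloc y)) loc_mulE.
by apply/loc_eqP; exists denom1; rewrite /= ?dval1; ring.
Qed.
HB.instance Definition _ :=
  GRing.isMonoidMorphism.Build A localized toloc toloc_is_monoid_morphism.

End Localization.

Definition dualmod (A : comNzRingType) (N : lmodType A) := {scalar N}.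

Section Dual.
Variables (A : comNzRingType) (N : lmodType A).

HB.instance Definition _ := gen_eqMixin (dualmod N).
HB.instance Definition _ := gen_choiceMixin (dualmod N).

Definition dual_fun (f : dualmod N) : N -> A := (f : {scalar N}).

Lemma dualP (f g : dualmod N) : (forall x, dual_fun f x = dual_fun g x) -> f = g.
Proof.
case: f g => [f [hD hZ]] [g [kD kZ]] /= fg.
have e : f = g by apply/funext.
case: _ / e kD kZ {fg} => kD kZ.
case: hD kD => hD [kD]; case: hZ kZ => hZ [kZ].
by rewrite (Prop_irrelevance hD kD) (Prop_irrelevance hZ kZ).
Qed.

Definition dual_zero : dualmod N := (\0 : {scalar N}).
Definition dual_opp (f : dualmod N) : dualmod N := (\- (f : {scalar N}) : {scalar N}).
Definition dual_add (f g : dualmod N) : dualmod N :=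
  ((f : {scalar N}) \+ (g : {scalar N}) : {scalar N}).

Lemma dual_addA : associative dual_add.
Proof. by move=> f g h; apply: dualP => x; apply: addrA. Qed.
Lemma dual_addC : commutative dual_add.
Proof. by move=> f g; apply: dualP => x; apply: addrC. Qed.
Lemma dual_add0 : left_id dual_zero dual_add.
Proof. by move=> f; apply: dualP => x; apply: add0r. Qed.
Lemma dual_addN : left_inverse dual_zero dual_opp dual_add.
Proof. by move=> f; apply: dualP => x; apply: addNr. Qed.
HB.instance Definition _ :=
  GRing.isZmodule.Build (dualmod N) dual_addA dual_addC dual_add0 dual_addN.

Section Scale.
Variables (a : A) (f : dualmod N).
Definition dual_scale_fun (x : N) : A := a * dual_fun f x.
Lemma dual_scale_is_scalar : scalar dual_scale_fun.
Proof.
move=> c x y; rewrite /dual_scale_fun /dual_fun linearP mulrDr.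
by rewrite /= mulrCA.
Qed.
HB.instance Definition _ :=
  GRing.isLinear.Build A N A *%R dual_scale_fun dual_scale_is_scalar.
Definition dual_scale : dualmod N := (dual_scale_fun : {scalar N}).
End Scale.

Lemma dual_scaleA a b f : dual_scale a (dual_scale b f) = dual_scale (a * b) f.
Proof. by apply: dualP => x; apply: mulrA. Qed.
Lemma dual_scale1 : left_id 1 dual_scale.
Proof. by move=> f; apply: dualP => x; apply: mul1r. Qed.
Lemma dual_scaleDr : right_distributive dual_scale +%R.
Proof. by move=> a f g; apply: dualP => x; apply: mulrDr. Qed.
Lemma dual_scaleDl f : {morph dual_scale^~ f : a b / a + b}.
Proof. by move=> a b; apply: dualP => x; apply: mulrDl. Qed.
HB.instance Definition _ := GRing.Zmodule_isLmodule.Build A (dualmod N)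
  dual_scaleA dual_scale1 dual_scaleDr dual_scaleDl.

End Dual.

Definition semilin (A B : comNzRingType) (phi : A -> B) (N : lmodType A)
    (W : lmodType B) (g : N -> W) : Prop :=
  forall a x y, g (a *: x + y) = phi a *: g x + g y.

Section ExtensionOfScalars.
Variables (A B : comNzRingType) (phi : {rmorphism A -> B}) (N : lmodType A).

(* The list [:: (b1, x1); ...; (bk, xk)] stands for the tensor
   b1 (x) x1 + ... + bk (x) xk of B (x)_A N. *)
Notation pre := (seq (B * N)).

Inductive tens_rel : pre -> pre -> Prop :=
| tens_refl l : tens_rel l l
| tens_sym l k : tens_rel l k -> tens_rel k l
| tens_trans l k m : tens_rel l k -> tens_rel k m -> tens_rel l m
| tens_cat l l' k k' : tens_rel l l' -> tens_rel k k' ->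
    tens_rel (l ++ k) (l' ++ k')
| tens_catC l k : tens_rel (l ++ k) (k ++ l)
| tens_0l x : tens_rel [:: (0, x)] [::]
| tens_Dl b c x : tens_rel [:: (b + c, x)] [:: (b, x); (c, x)]
| tens_Dr b x y : tens_rel [:: (b, x + y)] [:: (b, x); (b, y)]
| tens_bal b a x : tens_rel [:: (b * phi a, x)] [:: (b, a *: x)].

Definition tens_relb (l k : pre) : bool := `[< tens_rel l k >].

Lemma tens_relb_refl : reflexive tens_relb.
Proof. by move=> l; apply/asboolP; apply: tens_refl. Qed.
Lemma tens_relb_sym : symmetric tens_relb.
Proof. by move=> l k; apply/asboolP/asboolP; apply: tens_sym. Qed.
Lemma tens_relb_trans : transitive tens_relb.
Proof.
by move=> k l m /asboolP lk /asboolP km; apply/asboolP/(tens_trans lk km).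
Qed.

Canonical tens_equiv :=
  EquivRel tens_relb tens_relb_refl tens_relb_sym tens_relb_trans.

Definition ext := {eq_quot tens_relb}.
HB.instance Definition _ : EqQuotient _ tens_relb ext := EqQuotient.on ext.
HB.instance Definition _ := Choice.on ext.

Lemma ext_eqP (l k : pre) : \pi_ext l = \pi_ext k <-> tens_rel l k.
Proof. by split=> [/eqmodP/asboolP|h] //; apply/eqmodP/asboolP. Qed.

Lemma ext_reprP (l : pre) : tens_rel (repr (\pi_ext l)) l.
Proof. by apply/ext_eqP; rewrite reprK. Qed.

Definition pre_scale (b : B) (l : pre) : pre := [seq (b * c.1, c.2) | c <- l].

Lemma tens_rel_scale b l k :
  tens_rel l k -> tens_rel (pre_scale b l) (pre_scale b k).
Proof.
elim=> {l k} [l|l k _|l k m _ h _|l l' k k' _ h1 _ h2|l k|x|c d x|c x y|c a x].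
- exact: tens_refl.
- exact: tens_sym.
- exact: tens_trans.
- by rewrite /pre_scale !map_cat; apply: tens_cat.
- by rewrite /pre_scale !map_cat; apply: tens_catC.
- by rewrite /= mulr0; apply: tens_0l.
- by rewrite /= mulrDr; apply: tens_Dl.
- exact: tens_Dr.
- by rewrite /= mulrA; apply: tens_bal.
Qed.

Definition ext_add (s t : ext) : ext := \pi_ext (repr s ++ repr t).
Definition ext_scale (b : B) (t : ext) : ext := \pi_ext (pre_scale b (repr t)).

Lemma ext_addE l k : ext_add (\pi_ext l) (\pi_ext k) = \pi_ext (l ++ k).
Proof. by apply/ext_eqP/tens_cat; apply: ext_reprP. Qed.

Lemma ext_scaleE b l : ext_scale b (\pi_ext l) = \pi_ext (pre_scale b l).
Proof. exact/ext_eqP/tens_rel_scale/ext_reprP. Qed.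

Lemma ext_addA : associative ext_add.
Proof.
elim/quotW=> s; elim/quotW=> t; elim/quotW=> u.
by rewrite (ext_addE s t) (ext_addE t u) !ext_addE catA.
Qed.
Lemma ext_addC : commutative ext_add.
Proof.
elim/quotW=> s; elim/quotW=> t; rewrite (ext_addE s t) (ext_addE t s).
exact/ext_eqP/tens_catC.
Qed.
Lemma ext_add0 : left_id (\pi_ext [::]) ext_add.
Proof. by elim/quotW=> s; rewrite ext_addE. Qed.

Lemma pre_scaleDl b c l :
  tens_rel (pre_scale (b + c) l) (pre_scale b l ++ pre_scale c l).
Proof.
elim: l => [|[d x] l h] /=; first exact: tens_refl.
rewrite -cat1s -[_ :: pre_scale b l ++ _]cat1s.
apply: (tens_trans (k := [:: (b * d, x); (c * d, x)] ++
  (pre_scale b l ++ pre_scale c l))).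
  by rewrite mulrDl; apply: tens_cat h; apply: tens_Dl.
rewrite -[[:: _; _]]cat1s -catA; apply: tens_cat; first exact: tens_refl.
rewrite -[_ :: pre_scale c l]cat1s !catA.
by apply: tens_cat; [apply: tens_catC | apply: tens_refl].
Qed.

Lemma pre_scale0 l : tens_rel (pre_scale 0 l) [::].
Proof.
elim: l => [|[d x] l h] /=; first exact: tens_refl.
rewrite -cat1s -[[::]]cat0s; apply: tens_cat h.
by rewrite mul0r; apply: tens_0l.
Qed.

Lemma pre_scale1 l : pre_scale 1 l = l.
Proof. by elim: l => [|[d x] l h] //=; rewrite mul1r h. Qed.

Lemma ext_addN : left_inverse (\pi_ext [::]) (ext_scale (- 1)) ext_add.
Proof.
elim/quotW=> s; rewrite ext_scaleE ext_addE.
apply/ext_eqP; rewrite -[X in _ ++ X]pre_scale1.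
apply: tens_trans (tens_sym (pre_scaleDl _ _ _)) _.
by rewrite addNr; apply: pre_scale0.
Qed.

HB.instance Definition _ :=
  GRing.isZmodule.Build ext ext_addA ext_addC ext_add0 ext_addN.

Lemma ext_scaleA b c t : ext_scale b (ext_scale c t) = ext_scale (b * c) t.
Proof.
elim/quotW: t => t; rewrite (ext_scaleE c t) !ext_scaleE; congr \pi_ext.
by rewrite /pre_scale -map_comp; apply: eq_map => d /=; rewrite mulrA.
Qed.
Lemma ext_scale1 : left_id 1 ext_scale.
Proof. by elim/quotW=> t; rewrite ext_scaleE pre_scale1. Qed.
Lemma ext_scaleDr : right_distributive ext_scale +%R.
Proof.
move=> b; elim/quotW=> s; elim/quotW=> t.
rewrite -[\pi_ext s + _]/(ext_add _ _) -[RHS]/(ext_add _ _).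
by rewrite ext_addE !ext_scaleE ext_addE /pre_scale map_cat.
Qed.
Lemma ext_scaleDl t : {morph ext_scale^~ t : b c / b + c}.
Proof.
move=> b c; elim/quotW: t => t; rewrite -[RHS]/(ext_add _ _).
by rewrite !ext_scaleE ext_addE; apply/ext_eqP/pre_scaleDl.
Qed.
HB.instance Definition _ := GRing.Zmodule_isLmodule.Build B ext
  ext_scaleA ext_scale1 ext_scaleDr ext_scaleDl.

Definition tens (b : B) (x : N) : ext := \pi_ext [:: (b, x)].

Lemma piE l : \pi_ext l = \sum_(c <- l) tens c.1 c.2.
Proof.
elim: l => [|[b x] l h]; first by rewrite big_nil.
by rewrite big_cons -h -[RHS]/(ext_add _ _) ext_addE.
Qed.

Lemma scale_tens b c x : b *: tens c x = tens (b * c) x.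
Proof. exact: ext_scaleE. Qed.

Lemma tens1_semilin : semilin phi (tens 1).
Proof.
move=> a x y; rewrite scale_tens -[RHS]/(ext_add _ _) ext_addE.
apply/ext_eqP; apply: tens_trans (tens_Dr _ _ _) _.
rewrite -[[:: _; _]]cat1s; apply: tens_cat (tens_refl _).
by apply: tens_sym; rewrite mulr1 -[phi a]mul1r; apply: tens_bal.
Qed.

Section Lift.
Variables (C : comNzRingType) (psi : {rmorphism B -> C}) (W : lmodType C).
Variable g : N -> W.

(* The psi-semilinear map b (x) x |-> psi b *: g x. *)
Definition ext_lift (t : ext) : W := \sum_(c <- repr t) psi c.1 *: g c.2.

Hypothesis gP : semilin (fun a => psi (phi a)) g.

Lemma semilinD x y : g (x + y) = g x + g y.
Proof. by have := gP 1 x y; rewrite !rmorph1 !scale1r. Qed.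

Lemma semilin0 : g 0 = 0.
Proof. by apply: (addrI (g 0)); rewrite -semilinD !addr0. Qed.

Lemma semilinZ a x : g (a *: x) = psi (phi a) *: g x.
Proof. by have := gP a x 0; rewrite semilin0 !addr0. Qed.

Lemma ext_lift_rel l k : tens_rel l k ->
  \sum_(c <- l) psi c.1 *: g c.2 = \sum_(c <- k) psi c.1 *: g c.2.
Proof.
elim=> {l k} [l|l k _|l k m _ h _|l l' k k' _ h1 _ h2|l k|x|c d x|c x y|c a x] //.
- by move=> <-.
- by rewrite !big_cat /= h1 h2.
- by rewrite !big_cat /= addrC.
- by rewrite big_seq1 big_nil rmorph0 scale0r.
- by rewrite !(big_cons, big_nil) /= !addr0 rmorphD scalerDl.
- by rewrite !(big_cons, big_nil) /= !addr0 semilinD scalerDr.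
- by rewrite !big_seq1 /= semilinZ rmorphM scalerA.
Qed.

Lemma ext_lift_pi l : ext_lift (\pi_ext l) = \sum_(c <- l) psi c.1 *: g c.2.
Proof. exact/ext_lift_rel/ext_reprP. Qed.

Lemma ext_lift_tens b x : ext_lift (tens b x) = psi b *: g x.
Proof. by rewrite ext_lift_pi big_seq1. Qed.

Lemma ext_lift_semilin : semilin psi ext_lift.
Proof.
move=> b; elim/quotW=> s; elim/quotW=> t.
rewrite -[b *: _]/(ext_scale _ _) -[ext_scale _ _ + _]/(ext_add _ _).
rewrite ext_scaleE ext_addE !ext_lift_pi big_cat big_map scaler_sumr /=.
by congr (_ + _); apply: eq_bigr => c _; rewrite rmorphM scalerA.
Qed.

End Lift.

End ExtensionOfScalars.

Section QuadraticForms.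
Variables (A : comNzRingType) (N : lmodType A).

Definition polar (q : N -> A) (x y : N) : A := q (x + y) - q x - q y.

Definition is_quadratic (q : N -> A) : Prop :=
  [/\ forall a x, q (a *: x) = a ^+ 2 * q x,
      forall x, scalar (polar q x) & forall y, scalar (polar q ^~ y)].

Definition nondegenerate (q : N -> A) : Prop :=
  exists d : {linear N -> dualmod N},
    (forall z x, dual_fun (d z) x = polar q z x) /\ bijective d.

Definition quadratic_space (q : N -> A) : Prop :=
  [/\ finitely_generated N, projective N, is_quadratic q & nondegenerate q].

End QuadraticForms.

Section ExtendedForm.
Variables (A B : comNzRingType) (phi : {rmorphism A -> B}) (N : lmodType A).
Variable q : N -> A.

(* q_B (sum_i b_i (x) x_i)
   = sum_i b_i ^ 2 phi (q x_i) + sum_(i < j) b_i b_j phi <x_i, x_j>. *)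
Definition pre_polar (l k : seq (B * N)) : B :=
  \sum_(c <- l) \sum_(d <- k) c.1 * d.1 * phi (polar q c.2 d.2).

Fixpoint pre_quad (l : seq (B * N)) : B :=
  if l is c :: l' then
    c.1 ^+ 2 * phi (q c.2) + pre_polar [:: c] l' + pre_quad l'
  else 0.

Definition ext_quad (t : ext phi N) : B := pre_quad (repr t).

Hypothesis qP : is_quadratic q.

Lemma polarC x y : polar q x y = polar q y x.
Proof. by rewrite /polar [x + y]addrC; ring. Qed.

Lemma quad0 : q 0 = 0.
Proof. by case: qP => qZ _ _; rewrite -[0](scale0r 0) qZ expr0n mul0r. Qed.

Lemma polarDr x y z : polar q x (y + z) = polar q x y + polar q x z.
Proof. by case: qP => _ /(_ x 1 y z) + _; rewrite !scale1r mul1r. Qed.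

Lemma polar0r x : polar q x 0 = 0.
Proof. by rewrite /polar addr0 subrr sub0r quad0 oppr0. Qed.

Lemma polarZr a x y : polar q x (a *: y) = a * polar q x y.
Proof. by case: qP => _ /(_ x a y 0) + _; rewrite polar0r !addr0. Qed.

Lemma polarxx x : polar q x x = q x *+ 2.
Proof.
case: qP => qZ _ _; rewrite /polar -[x in q (x + _)]scale1r -[x in _ *: _ + x]scale1r.
by rewrite -scalerDl qZ; ring.
Qed.

Lemma pre_polarC l k : pre_polar l k = pre_polar k l.
Proof.
rewrite /pre_polar exchange_big; apply: eq_bigr => c _; apply: eq_bigr => d _.
by rewrite /= polarC [d.1 * _]mulrC.
Qed.

Lemma pre_polar_catr l k m :
  pre_polar l (k ++ m) = pre_polar l k + pre_polar l m.
Proof. by rewrite -big_split; apply: eq_bigr => c _; rewrite big_cat. Qed.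

Lemma pre_polar_catl l k m :
  pre_polar (k ++ m) l = pre_polar k l + pre_polar m l.
Proof. by rewrite /pre_polar big_cat. Qed.

Lemma pre_polar0r l : pre_polar l [::] = 0.
Proof. by apply: big1 => c _; rewrite big_nil. Qed.

Lemma pre_polar0l l : pre_polar [::] l = 0.
Proof. by rewrite /pre_polar big_nil. Qed.

Lemma pre_quad_cat l k : pre_quad (l ++ k) = pre_quad l + pre_quad k + pre_polar l k.
Proof.
elim: l => [|c l h] /=; first by rewrite pre_polar0l addr0 add0r.
by rewrite h pre_polar_catr -[c :: l]cat1s pre_polar_catl; ring.
Qed.

Lemma pre_polar_relr m l k :
  tens_rel phi l k -> pre_polar m l = pre_polar m k.
Proof.
elim=> {l k} [l|l k _|l k n _ h _|l l' k k' _ h1 _ h2|l k|x|c d x|c x y|c a x] //.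
- by move=> <-.
- by rewrite !pre_polar_catr h1 h2.
- by rewrite !pre_polar_catr addrC.
- by rewrite pre_polar0r; apply: big1 => c _; rewrite big_seq1 /=; ring.
- apply: eq_bigr => e _; rewrite !(big_cons, big_nil) /= !addr0; ring.
- apply: eq_bigr => e _; rewrite !(big_cons, big_nil) /= !addr0 polarDr rmorphD; ring.
- apply: eq_bigr => e _; rewrite !big_seq1 /= polarZr rmorphM; ring.
Qed.

Lemma pre_polar_rel l l' k k' : tens_rel phi l l' -> tens_rel phi k k' ->
  pre_polar l k = pre_polar l' k'.
Proof.
move=> ll' kk'; rewrite (pre_polar_relr l kk') ![pre_polar _ k']pre_polarC.
exact: pre_polar_relr.
Qed.

Lemma pre_quad_rel l k : tens_rel phi l k -> pre_quad l = pre_quad k.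
Proof.
have [qZ _ _] := qP.
elim=> {l k} [l|l k _|l k n _ h _|l l' k k' r1 h1 r2 h2|l k|x|c d x|c x y|c a x] //.
- by move=> <-.
- by rewrite !pre_quad_cat h1 h2 (pre_polar_rel r1 r2).
- by rewrite !pre_quad_cat [in RHS]pre_polarC [pre_quad k + _]addrC.
- by rewrite /= pre_polar0r; ring.
- rewrite /= !pre_polar0r /pre_polar !big_seq1 /= polarxx rmorphMn; ring.
- rewrite /= !pre_polar0r /pre_polar !big_seq1 /=.
  have -> : q (x + y) = q x + q y + polar q x y by rewrite /polar; ring.
  by rewrite !rmorphD; ring.
- by rewrite /= !pre_polar0r qZ rmorphM rmorphXn; ring.
Qed.

Lemma ext_quad_pi l : ext_quad (\pi_(ext phi N) l) = pre_quad l.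
Proof. exact/pre_quad_rel/ext_reprP. Qed.

Lemma ext_quad_tens b x : ext_quad (tens phi b x) = b ^+ 2 * phi (q x).
Proof. by rewrite ext_quad_pi /= pre_polar0r !addr0. Qed.

Lemma ext_polar_pi l k :
  polar ext_quad (\pi_(ext phi N) l) (\pi_(ext phi N) k) = pre_polar l k.
Proof.
rewrite /polar -[\pi_(ext phi N) l + _]/(ext_add _ _) ext_addE !ext_quad_pi.
by rewrite pre_quad_cat; ring.
Qed.

Lemma ext_quad_quadratic : is_quadratic ext_quad.
Proof.
have polarC' s t : polar ext_quad s t = polar ext_quad t s.
  by rewrite /polar [s + t]addrC; ring.
have polarr s : scalar (polar ext_quad s).
  elim/quotW: s => l b; elim/quotW => k; elim/quotW => m.
  rewrite -[b *: _]/(ext_scale _ _) -[ext_scale _ _ + _]/(ext_add _ _).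
  rewrite ext_scaleE ext_addE !ext_polar_pi pre_polar_catr; congr (_ + _).
  rewrite mulr_sumr; apply: eq_bigr => c _; rewrite mulr_sumr big_map.
  by apply: eq_bigr => d _ /=; ring.
split=> //.
- move=> b; elim/quotW=> l; rewrite -[b *: _]/(ext_scale _ _) ext_scaleE.
  rewrite !ext_quad_pi; elim: l => [|c l h] /=; first by rewrite mulr0.
  rewrite h; suff -> : pre_polar [:: (b * c.1, c.2)] (pre_scale b l) =
    b ^+ 2 * pre_polar [:: c] l by ring.
  rewrite /pre_polar !big_seq1 big_map mulr_sumr.
  by apply: eq_bigr => d _ /=; ring.
- by move=> t b s u; rewrite !(polarC' _ t) polarr.
Qed.

End ExtendedForm.

Arguments ext_quad {A B} phi {N} q t.

Section Subgroups.
Variable T : Type.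

Inductive generated (S : set (T -> T)) : set (T -> T) :=
| generated_id : generated S id
| generated_mem g : S g -> generated S g
| generated_comp g h : generated S g -> generated S h -> generated S (g \o h)
| generated_inv g h : generated S g -> cancel g h -> cancel h g ->
    generated S h.

Definition normal_closure (G H : set (T -> T)) : set (T -> T) :=
  generated (fun f => exists g g' h,
    [/\ G g, cancel g g', cancel g' g, H h & f = g \o h \o g']).

End Subgroups.

(* The inverse of 2, when there is one. *)
Definition inv2 (A : comNzRingType) : A := xget 0 (fun h : A => 2%:R * h = 1).

Section ElementaryOrthogonal.
Variables (A : comNzRingType) (Q P : lmodType A) (q : Q -> A).

(* Q _|_ H(P), elements being written (z, x, f). *)
Definition hyp := (Q * P * dualmod P)%type.
HB.instance Definition _ := GRing.Lmodule.on hyp.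

Definition hyp_quad (u : hyp) : A := q u.1.1 + dual_fun u.2 u.1.2.

Definition orthogonal_group : set (hyp -> hyp) := fun g =>
  [/\ linear g, bijective g &
      forall u v, polar hyp_quad (g u) (g v) = polar hyp_quad u v].

Definition E_alpha (alpha : Q -> P) (alpha' : dualmod P -> Q) (u : hyp) : hyp :=
  let: (z, x, f) := u in
  (z - alpha' f, x + alpha z - inv2 A *: alpha (alpha' f), f).

Definition E_beta (beta : Q -> dualmod P) (beta' : P -> Q) (u : hyp) : hyp :=
  let: (z, x, f) := u in
  (z - beta' x, x, beta z - inv2 A *: beta (beta' x) + f).

(* alpha' and beta' are the adjoints alpha^*, beta^*; they are unique as soon
   as q is non-degenerate. *)
Definition elementary (J : set A) : set (hyp -> hyp) := fun g =>
  (exists (alpha : {linear Q -> P}) (alpha' : {linear dualmod P -> Q}),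
    [/\ forall z, ideal_mul P J (alpha z),
        forall f z, polar q (alpha' f) z = dual_fun f (alpha z)
      & g = E_alpha alpha alpha']) \/
  (exists (beta : {linear Q -> dualmod P}) (beta' : {linear P -> Q}),
    [/\ forall z, ideal_mul (dualmod P) J (beta z),
        forall x z, polar q (beta' x) z = dual_fun (beta z) x
      & g = E_beta beta beta']).

Definition EO (J : set A) : set (hyp -> hyp) := generated (elementary J).

Definition EO_rel (J : set A) : set (hyp -> hyp) :=
  normal_closure (EO setT) (EO J).

End ElementaryOrthogonal.

Notation polyExt N := (ext polyC N).
Notation locExt p N := (ext (toloc p) N).

Definition has_rank (A : comNzRingType) (N : lmodType A) (n : nat) : Prop :=
  forall p : primeIdeal A,
    exists f : {linear locExt p N -> 'rV[localized p]_n}, bijective f.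

Section EvaluationAt0.
Variables (R : comNzRingType) (Q P : lmodType R).

Definition ev0 (N : lmodType R) : polyExt N -> N := ext_lift (horner_eval 0) id.

Section Dual.
Variable f : dualmod (polyExt P).
Definition dual_ev0_fun (x : P) : R := (dual_fun f (tens polyC 1 x)).[0].
Lemma dual_ev0_is_scalar : scalar dual_ev0_fun.
Proof.
move=> a x y; rewrite /dual_ev0_fun /dual_fun tens1_semilin linearP.
by rewrite hornerD hornerM hornerC.
Qed.
HB.instance Definition _ :=
  GRing.isLinear.Build R P R *%R dual_ev0_fun dual_ev0_is_scalar.
Definition dual_ev0 : dualmod P := (dual_ev0_fun : {scalar P}).
End Dual.

Lemma ev0_semilin (N : lmodType R) : semilin (horner_eval 0) (@ev0 N).
Proof. by apply: ext_lift_semilin => a x y /=; rewrite /horner_eval hornerC. Qed.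

Lemma dual_ev0P f x : dual_fun (dual_ev0 f) (ev0 x) = (dual_fun f x).[0].
Proof.
have idP : semilin (fun a => horner_eval (0 : R) a%:P) (@id P).
  by move=> a y z; rewrite /horner_eval hornerC.
elim/quotW: x => l; rewrite /ev0 ext_lift_pi // piE /dual_fun !linear_sum.
rewrite -horner_evalE linear_sum; apply: eq_bigr => c _ /=.
rewrite linearZ -[c.1 in RHS]mulr1 -scale_tens linearZ /=.
by rewrite /dual_ev0_fun /horner_eval hornerM.
Qed.

(* (P[X])^* plays the role of P^*[X]; by dual_ev0P, dual_ev0 f is the form
   induced by f modulo X. *)
Definition hyp_ev0 (u : hyp (polyExt Q) (polyExt P)) : hyp Q P :=
  (ev0 u.1.1, ev0 u.1.2, dual_ev0 u.2).

End EvaluationAt0.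

Section LocalizationX.
Variables (R : comNzRingType) (p : primeIdeal R) (Q P : lmodType R).

Definition polyLoc : {poly R} -> {poly localized p} := map_poly (toloc p).
HB.instance Definition _ := GRing.RMorphism.on polyLoc.

Definition locX (N : lmodType R) : polyExt N -> polyExt (locExt p N) :=
  ext_lift polyLoc (fun x => tens polyC 1 (tens (toloc p) 1 x)).

Lemma locX_tens_semilin (N : lmodType R) :
  semilin (fun a => polyLoc a%:P) (fun x : N => tens polyC 1 (tens (toloc p) 1 x)).
Proof.
by move=> a x y; rewrite tens1_semilin tens1_semilin /polyLoc map_polyC.
Qed.

Lemma locX_semilin (N : lmodType R) : semilin polyLoc (@locX N).
Proof. exact/ext_lift_semilin/locX_tens_semilin. Qed.

Section Dual.
Variable f : dualmod (polyExt P).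

(* The form sending b (x) (a (x) x) to b a f(1 (x) x). *)
Definition dual_locX_aux : locExt p P -> {poly localized p} :=
  ext_lift (W := {poly localized p}^o) polyC
    (fun x => polyLoc (dual_fun f (tens polyC 1 x))).
Definition dual_locX_fun : polyExt (locExt p P) -> {poly localized p} :=
  ext_lift (W := {poly localized p}^o) idfun dual_locX_aux.

Lemma dual_locX_aux0 : semilin (W := {poly localized p}^o) (fun a => (toloc p a)%:P)
    (fun x => polyLoc (dual_fun f (tens polyC 1 x))).
Proof.
move=> a x y; rewrite tens1_semilin /dual_fun linearP rmorphD rmorphM /=.
by rewrite /polyLoc map_polyC.
Qed.

Lemma dual_locX_auxP :
  semilin (W := {poly localized p}^o) polyC dual_locX_aux.
Proof. exact/ext_lift_semilin/dual_locX_aux0. Qed.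

Lemma dual_locX_is_scalar : scalar dual_locX_fun.
Proof.
apply: (@ext_lift_semilin _ _ polyC _ _ idfun {poly localized p}^o).
exact: dual_locX_auxP.
Qed.
HB.instance Definition _ := GRing.isLinear.Build {poly localized p}
  (polyExt (locExt p P)) {poly localized p} *%R dual_locX_fun dual_locX_is_scalar.
Definition dual_locX : dualmod (polyExt (locExt p P)) :=
  (dual_locX_fun : {scalar polyExt (locExt p P)}).

End Dual.

Lemma dual_locXP f x :
  dual_fun (dual_locX f) (locX x) = polyLoc (dual_fun f x).
Proof.
elim/quotW: x => l; rewrite /locX ext_lift_pi; last exact: locX_tens_semilin.
rewrite piE /dual_fun !linear_sum rmorph_sum; apply: eq_bigr => c _ /=.
rewrite -[c.1 in RHS]mulr1 -scale_tens !linearZ rmorphM /=; congr (_ * _).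
rewrite /dual_locX_fun (ext_lift_tens (psi := idfun)); last exact: dual_locX_auxP.
rewrite /dual_locX_aux ext_lift_tens; last exact: dual_locX_aux0.
by rewrite !scale1r.
Qed.

(* The canonical map M[X] -> M_p[X]; by dual_locXP, dual_locX f is the
   base change of the form f along R[X] -> R_p[X]. *)
Definition hyp_locX (u : hyp (polyExt Q) (polyExt P)) :
    hyp (polyExt (locExt p Q)) (polyExt (locExt p P)) :=
  (locX u.1.1, locX u.1.2, dual_locX u.2).

End LocalizationX.

(* Main.v *)
Require Import Defs.
From HB Require Import structures.
From mathcomp Require Import all_boot all_order all_algebra.
From mathcomp Require Import generic_quotient ring.
From mathcomp Require Import boolp classical_sets.

(** Write T_(u,v) for the Siegel transvection of an isotropic vector u and a
    vector v orthogonal to u, the exponential of the bivector of u and v. It is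
    additive in v, and an isometry g conjugates T_(u,v) to T_(g u, g v). The
    maps E_alpha and E^*_beta with alpha and beta of rank one are the
    transvections with u in P or in P^* and v in Q.

    The relative group is handled by excision: g lies in the normal closure
    attached to I as soon as the pair (g, 1) is a product of pairs of elementary
    maps that agree modulo I. Hence all words below are families indexed by
    bool, congruent modulo I, and the commutator calculus is done once, for the
    absolute and the relative group at the same time.

    Over a maximal ideal p, let K be the local ring. There P becomes free, with
    hyperbolic vectors e_b (the axes), and Q contains two vectors with product 1.
    Every elementary map over K[X] is a word in the transvections T_(e_b, x) with
    x in Q (eichler_mem). Call a word s-divisible when all its vectors x are s
    times vectors defined over R[X].
    - conj_mem: conjugation by T_(e_b, x), where d x is defined over R[X], takes
      sufficiently divisible words to s-divisible ones, with a bound that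
      depends on s and d only. The one difficult case is that of opposite axes:
      the transvection is first factored through a second hyperbolic plane,
      which exists because P has rank at least 2 (opp_factor). The planes of two
      axes are reached by commutators, which is what the vectors with product 1
      are for.
    - words_shift: therefore, for a word g(X), the word
      g((b + t c) X) g(b X)^-1 is s-divisible for a suitable denominator t and
      all b and c in R.
    - words_lift: divisible words come from pairs of elementary maps over R[X]
      that are congruent to 1 modulo a prescribed element.

    All modules M[X] are used through a frame: a finite generating family with
    coordinate functions whose mutual values are constants. A frame makes the
    substitution of b X for X, the clearing of denominators and the base change
    to K[X] operations on coordinates.

    For alpha as in the theorem, let J be the set of the t such that
    alpha((b + t c) X) alpha(b X)^-1 is in the relative group for all b and c.
    It is an ideal, by telescoping. By the local analysis it contains an element
    outside of each maximal ideal: the local identity descends to R[X] because,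
    R being Noetherian, one element s' outside of p kills the kernel of R -> K,
    and both sides are congruent modulo s' (lam_inj). So 1 is in J, and b = 0,
    c = 1 give the theorem since alpha(0) = 1. *)

Set Implicit Arguments.
Unset Strict Implicit.
Unset Printing Implicit Defensive.

Import GRing.Theory.
Local Open Scope ring_scope.
Local Open Scope quotient_scope.

(** * Quadratic forms *)

Section Polar.
Variables (A : comNzRingType) (V : lmodType A) (q : V -> A).
Hypothesis qP : is_quadratic q.

Lemma quadZ a x : q (a *: x) = a ^+ 2 * q x. Proof. by case: qP. Qed.

Lemma quadD x y : q (x + y) = q x + q y + polar q x y.
Proof. by rewrite /polar; ring. Qed.

Lemma polarDl x y z : polar q (x + y) z = polar q x z + polar q y z.
Proof. by rewrite ![polar q _ z]polarC polarDr. Qed.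

Lemma polarZl a x y : polar q (a *: x) y = a * polar q x y.
Proof. by rewrite ![polar q _ y]polarC polarZr. Qed.

Lemma polarNr x y : polar q x (- y) = - polar q x y.
Proof. by rewrite -scaleN1r polarZr // mulN1r. Qed.

Lemma polarNl x y : polar q (- x) y = - polar q x y.
Proof. by rewrite ![polar q _ y]polarC polarNr. Qed.

Lemma polar0l y : polar q 0 y = 0.
Proof. by rewrite polarC polar0r. Qed.

Lemma quadN x : q (- x) = q x.
Proof. by rewrite -scaleN1r quadZ sqrrN expr1n mul1r. Qed.

Lemma polar_sumr I (r : seq I) (P : pred I) (F : I -> V) x :
  polar q x (\sum_(i <- r | P i) F i) = \sum_(i <- r | P i) polar q x (F i).
Proof. exact: (big_morph (polar q x) (polarDr qP x) (polar0r qP x)). Qed.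

Lemma polar_suml I (r : seq I) (P : pred I) (F : I -> V) x :
  polar q (\sum_(i <- r | P i) F i) x = \sum_(i <- r | P i) polar q (F i) x.
Proof. by rewrite polarC polar_sumr; apply: eq_bigr => i _; rewrite polarC. Qed.

Definition polarE := (polarDl, polarDr qP, polarZl, polarZr qP, polarNl, polarNr,
  polar0l, polar0r qP).

End Polar.

(** * Linear identities in modules *)

Section TrivialExtension.
Variables (A : comNzRingType) (V : lmodType A).

(** The square-zero extension of A by V is a commutative ring that contains V,
    so that the decision procedure for commutative rings proves identities
    between linear combinations of vectors. *)
Definition trivext := (A * V)%type.
HB.instance Definition _ := GRing.Zmodule.on trivext.

Definition trivext_one : trivext := (1, 0).
Definition trivext_mul (s t : trivext) : trivext :=
  (s.1 * t.1, s.1 *: t.2 + t.1 *: s.2).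

Lemma trivext_mulA : associative trivext_mul.
Proof.
move=> [a x] [b y] [c z]; rewrite /trivext_mul /= mulrA !scalerDr !scalerA.
by rewrite [c * b]mulrC [c * a]mulrC addrA.
Qed.
Lemma trivext_mulC : commutative trivext_mul.
Proof. by move=> [a x] [b y]; rewrite /trivext_mul /= mulrC addrC. Qed.
Lemma trivext_mul1 : left_id trivext_one trivext_mul.
Proof. by move=> [a x]; rewrite /trivext_mul /= mul1r scale1r scaler0 addr0. Qed.
Lemma trivext_mulD : left_distributive trivext_mul +%R.
Proof.
move=> [a x] [b y] [c z]; rewrite /trivext_mul /= mulrDl scalerDr scalerDl.
by congr (_, _); rewrite /= addrACA.
Qed.
Lemma trivext_1neq0 : trivext_one != 0.
Proof. by apply/eqP => -[/eqP]; rewrite oner_eq0. Qed.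
HB.instance Definition _ := GRing.Zmodule_isComNzRing.Build trivext
  trivext_mulA trivext_mulC trivext_mul1 trivext_mulD trivext_1neq0.

Definition trivS (a : A) : trivext := (a, 0).
Lemma trivS_zmod : zmod_morphism trivS.
Proof. by move=> a b; congr (_, _); rewrite /= subr0. Qed.
HB.instance Definition _ := GRing.isZmodMorphism.Build A trivext trivS trivS_zmod.
Lemma trivS_monoid : monoid_morphism trivS.
Proof. by split=> // a b; congr (_, _); rewrite /= !scaler0 addr0. Qed.
HB.instance Definition _ := GRing.isMonoidMorphism.Build A trivext trivS trivS_monoid.

Definition trivV (x : V) : trivext := (0, x).
Lemma trivVD x y : trivV (x + y) = trivV x + trivV y.
Proof. by congr (_, _); rewrite /= addr0. Qed.
Lemma trivVN x : trivV (- x) = - trivV x.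
Proof. by congr (_, _); rewrite /= oppr0. Qed.
Lemma trivVZ a x : trivV (a *: x) = trivS a * trivV x.
Proof. by congr (_, _); rewrite /= ?mulr0 // scale0r addr0. Qed.

Lemma trivV_inj : injective trivV. Proof. by move=> x y []. Qed.

End TrivialExtension.

Ltac lincomb :=
  apply: trivV_inj; rewrite !(trivVD, trivVN, trivVZ);
  ring.

(** * Siegel transvections *)

Section Transvections.
Variables (A : comNzRingType) (V : lmodType A) (q : V -> A).
Hypothesis qP : is_quadratic q.
Local Notation B := (polar q).

(** For isotropic u orthogonal to v, this is the exponential of the bivector of
    u and v, that is of the nilpotent map sending y to <u,y> v - <v,y> u. *)
Definition transv (u v y : V) : V :=
  y + (B u y *: v - (B v y + q v * B u y) *: u).

Lemma transv_linear u v : linear (transv u v).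
Proof.
move=> a x y; rewrite /transv !(polarE qP); lincomb.
Qed.

Lemma quad_transv u v y : q u = 0 -> B u v = 0 -> q (transv u v y) = q y.
Proof.
move=> u0 uv; have vu : B v u = 0 by rewrite polarC.
rewrite /transv !(quadD q, quadZ qP, quadN qP, polarE qP) ?(u0, uv, vu).
by rewrite [B y v]polarC [B y u]polarC; ring.
Qed.

Lemma transv_conj (g : V -> V) u v y : linear g -> (forall x, q (g x) = q x) ->
  g (transv u v y) = transv (g u) (g v) (g y).
Proof.
move=> glin gq.
have gD x z : g (x + z) = g x + g z by have := glin 1 x z; rewrite !scale1r.
have g0 : g 0 = 0 by apply: (addrI (g 0)); rewrite -gD !addr0.
have gZ a x : g (a *: x) = a *: g x by have := glin a x 0; rewrite g0 !addr0.
have gN x : g (- x) = - g x by rewrite -scaleN1r gZ scaleN1r.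
have gB x z : B (g x) (g z) = B x z by rewrite /polar -gD !gq.
by rewrite /transv !gB gq !gD gN !gZ.
Qed.

(** The bivectors of (u, v) and (u, v') commute since u is isotropic. *)
Lemma transvD u v v' y : q u = 0 -> B u v = 0 -> B u v' = 0 ->
  transv u v (transv u v' y) = transv u (v + v') y.
Proof.
move=> u0 uv uv'; have vu : B v u = 0 by rewrite polarC.
have uu : B u u = 0 by rewrite polarxx // u0 mul0rn.
rewrite /transv !(quadD q, polarE qP) ?(uv, uv', uu, vu); lincomb.
Qed.

Lemma transv0 u y : transv u 0 y = y.
Proof. by rewrite /transv (polarE qP) quad0 // scaler0 mul0r addr0 scale0r subr0 addr0. Qed.

Lemma transvK u v : q u = 0 -> B u v = 0 -> cancel (transv u (- v)) (transv u v).
Proof. by move=> u0 uv y; rewrite transvD ?(polarE qP) ?uv ?oppr0 // subrr transv0. Qed.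

Lemma transvNK u v : q u = 0 -> B u v = 0 -> cancel (transv u v) (transv u (- v)).
Proof. by move=> u0 uv y; rewrite transvD ?(polarE qP) ?uv ?oppr0 // addNr transv0. Qed.

Lemma transvZ c u v y : transv (c *: u) v y = transv u (c *: v) y.
Proof.
by rewrite /transv !(polarE qP) (quadZ qP); lincomb.
Qed.

(** The bivectors of (u, w) and (u', w) do not commute: their commutator is
    2 q(w) times the bivector of (u, u'), which commutes with both. The third
    factor is the resulting correction. *)
Lemma transvDl u u' w y : q u = 0 -> q u' = 0 -> B u u' = 0 -> B u w = 0 ->
    B u' w = 0 ->
  transv (u + u') w y = transv u w (transv u' w (transv u (- (q w *: u')) y)).
Proof.
move=> u0 u'0 uu' uw u'w.
have uu : B u u = 0 by rewrite polarxx // u0 mul0rn.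
have u'u' : B u' u' = 0 by rewrite polarxx // u'0 mul0rn.
have u'u : B u' u = 0 by rewrite polarC.
have wu : B w u = 0 by rewrite polarC.
have wu' : B w u' = 0 by rewrite polarC.
have e1 : transv u (- (q w *: u')) y =
    y + ((q w * B u' y) *: u - (q w * B u y) *: u').
  rewrite /transv !(polarE qP) (quadN qP) (quadZ qP) u'0; lincomb.
rewrite e1 /transv !(polarE qP) ?(uu, u'u', uu', u'u, uw, u'w, wu, wu').
rewrite (polarxx qP); lincomb.
Qed.

Section Eichler.
Variable h : A.
Hypothesis h2 : 2%:R * h = 1.

Implicit Types (l : seq (V * V)) (c : V * V).

Definition lower l (y : V) : V := \sum_(c <- l) B c.1 y *: c.2.
Definition upper l (y : V) : V := \sum_(c <- l) B c.2 y *: c.1.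

(** When the first components of the pairs are totally isotropic and orthogonal
    to the second ones, this is the exponential of the sum of the bivectors of
    the pairs: the common shape of the two kinds of elementary maps. *)
Definition eichler l (y : V) : V :=
  y - lower l y + upper l y - h *: upper l (lower l y).

Lemma lower_cons c l y : lower (c :: l) y = B c.1 y *: c.2 + lower l y.
Proof. by rewrite /lower big_cons. Qed.
Lemma upper_cons c l y : upper (c :: l) y = B c.2 y *: c.1 + upper l y.
Proof. by rewrite /upper big_cons. Qed.

Lemma eichler_nil y : eichler [::] y = y.
Proof. by rewrite /eichler /lower /upper !big_nil scaler0 !subr0 addr0. Qed.

Lemma eichler_trivial l y : {in l, forall c, c.2 = 0} -> eichler l y = y.
Proof.
move=> l0; have up0 x : upper l x = 0.
  by rewrite /upper big1_seq // => c /andP[_ /l0 ->]; rewrite (polar0l qP) scale0r.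
have low0 x : lower l x = 0.
  by rewrite /lower big1_seq // => c /andP[_ /l0 ->]; rewrite scaler0.
by rewrite /eichler !up0 !low0 scaler0 !subr0 addr0.
Qed.

Lemma polar_upper l x y : B x (upper l y) = \sum_(c <- l) B c.2 y * B x c.1.
Proof.
by rewrite (polar_sumr qP); apply: eq_bigr => c _; rewrite (polarZr qP).
Qed.

Lemma polar_lower l x y : B x (lower l y) = \sum_(c <- l) B c.1 y * B x c.2.
Proof.
by rewrite (polar_sumr qP); apply: eq_bigr => c _; rewrite (polarZr qP).
Qed.

Lemma upperD l x y : upper l (x + y) = upper l x + upper l y.
Proof.
by rewrite -big_split; apply: eq_bigr => c _; rewrite (polarDr qP) scalerDl.
Qed.

Lemma upperZ l a x : upper l (a *: x) = a *: upper l x.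
Proof.
by rewrite scaler_sumr; apply: eq_bigr => c _; rewrite (polarZr qP) scalerA.
Qed.

Lemma quad_half x : q x = h * B x x.
Proof. by rewrite polarxx // -mulr_natl mulrA [h * _]mulrC h2 mul1r. Qed.

(** Splitting off the first pair, the cross terms are those of half the
    commutator of two bivectors, which is the bivector of u and upper l z. *)
Lemma eichler_cons l u z y : q u = 0 -> B u z = 0 ->
    {in l, forall c, [/\ B u c.1 = 0, B u c.2 = 0 & B z c.1 = 0]} ->
    {in l &, forall c d, B c.1 d.1 = 0 /\ B c.1 d.2 = 0} ->
  eichler ((u, z) :: l) y = transv u (- (z + h *: upper l z)) (eichler l y).
Proof.
move=> u0 uz lu ll.
have z_up x : B z (upper l x) = 0.
  by rewrite polar_upper big1_seq // => c /andP[_ /lu[_ _ ->]]; rewrite mulr0.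
have u_up x : B u (upper l x) = 0.
  by rewrite polar_upper big1_seq // => c /andP[_ /lu[-> _ _]]; rewrite mulr0.
have u_low x : B u (lower l x) = 0.
  by rewrite polar_lower big1_seq // => c /andP[_ /lu[_ -> _]]; rewrite mulr0.
have up_up x x' : B (upper l x) (upper l x') = 0.
  rewrite polar_upper big1_seq // => c /andP[_ cl].
  rewrite [B (upper _ _) _]polarC polar_upper big1_seq ?mulr0 // => d /andP[_ dl].
  by rewrite (ll c d cl dl).1 mulr0.
have up_low x x' : B (upper l x) (lower l x') = 0.
  rewrite polar_lower big1_seq // => c /andP[_ cl].
  rewrite [B (upper _ _) _]polarC polar_upper big1_seq ?mulr0 // => d /andP[_ dl].
  by rewrite [B c.2 _]polarC (ll d c dl cl).2 mulr0.
have z_low x : B z (lower l x) = B (upper l z) x.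
  rewrite polar_lower polarC polar_upper; apply: eq_bigr => c _.
  by rewrite [B x _]polarC [B z _]polarC mulrC.
have qz : q (- (z + h *: upper l z)) = h * B z z.
  rewrite quad_half !(polarE qP) z_up up_up [B (upper _ _) z]polarC z_up; ring.
rewrite /transv qz /eichler lower_cons !upper_cons /= upperD upperZ !(polarE qP).
rewrite ?(uz, u_up, u_low, z_up, up_up, up_low, z_low).
apply/eqP; rewrite -subr_eq0.
set b := B (upper l z) y.
apply/eqP; transitivity (((1 - 2%:R * h) * b) *: u).
  lincomb.
by rewrite h2 subrr mul0r scale0r.
Qed.

End Eichler.

End Transvections.

(** * Words in transvections along axes *)

(** Hyperbolic vectors over a localized ring A, together with what is defined
    before localization: den are the denominators, scal the scalars and lat the
    vectors, all orthogonal to the axes. The latter two are sets of families indexed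
    by bool: in the application the two members are congruent modulo an ideal,
    so that a family stands for an element of the double of the ring along that
    ideal. The vectors vv and ww produce all scalars as products of vectors, dd
    being a common denominator for them. *)
Record lattice (A : comNzRingType) (V : lmodType A) (q : V -> A) := Lattice {
  wrank : nat;
  axis : 'I_wrank * bool -> V;
  den : A -> Prop;
  scal : (bool -> A) -> Prop;
  lat : (bool -> V) -> Prop;
  vv : V;
  ww : V;
  dd : A;
  wrank_gt1 : (1 < wrank)%N;
  axis_quad b : q (axis b) = 0;
  axis_polar b c : polar q (axis b) (axis c) = (c == (b.1, ~~ b.2))%:R;
  den1 : den 1;
  denM s t : den s -> den t -> den (s * t);
  den_unit s : den s -> exists t, t * s = 1;
  scal_den s : den s -> scal (fun=> s);
  scal0 : scal (fun=> 0);
  scalN c : scal c -> scal (fun k => - c k);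
  scalM c d : scal c -> scal d -> scal (fun k => c k * d k);
  latD x y : lat x -> lat y -> lat (fun k => x k + y k);
  latZ c x : scal c -> lat x -> lat (fun k => c k *: x k);
  lat_orth x b k : lat x -> polar q (axis b) (x k) = 0;
  lat_polar x y : lat x -> lat y -> scal (fun k => polar q (x k) (y k));
  lat_quad x : lat x -> scal (fun k => q (x k));
  vv_ww : polar q vv ww = 1;
  den_dd : den dd;
  lat_vv : lat (fun=> dd *: vv);
  lat_ww : lat (fun=> dd *: ww) }.

Arguments axis {A V q} l b.

Section Words.
Variables (A : comNzRingType) (V : lmodType A) (q : V -> A).
Hypothesis qP : is_quadratic q.
Variable D : lattice q.
Local Notation B := (polar q).
Local Notation e := (axis D).
Local Notation idx := ('I_(wrank D) * bool)%type.
Local Notation den := (den D).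
Local Notation scal := (scal D).
Local Notation lat := (lat D).
Local Notation d0 := (dd D).

Definition ptransv (b : idx) (x : bool -> V) : bool -> V -> V :=
  fun k => transv q (e b) (x k).

Definition paircomp (g h : bool -> V -> V) : bool -> V -> V := fun k => g k \o h k.
Local Notation "g \oo h" := (paircomp g h) (at level 50, left associativity).

Inductive words (X : (bool -> V) -> Prop) : (bool -> V -> V) -> Prop :=
| words1 : words X (fun=> id)
| wordsM b x g : X x -> words X g -> words X (ptransv b x \oo g).

Lemma words_eq X g g' : (forall k y, g k y = g' k y) -> words X g -> words X g'.
Proof. by move=> e; have -> : g = g' by apply/funext => k; apply/funext. Qed.

Lemma words_comp X g h : words X g -> words X h -> words X (g \oo h).
Proof. by move=> + Xh; elim=> [|b x g' Xx _ IH] //; apply: (wordsM b Xx). Qed.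

Lemma words_gen (X : (bool -> V) -> Prop) b x : X x -> words X (ptransv b x).
Proof. by move=> Xx; apply: (wordsM b Xx (words1 X)). Qed.

Definition smult (s : A) (x : bool -> V) : Prop :=
  exists2 z, lat z & x = (fun k => s *: z k).

Definition fractional (x : bool -> V) : Prop :=
  exists2 d, den d & lat (fun k => d *: x k).

Lemma den_inj d (x : V) : den d -> d *: x = 0 -> x = 0.
Proof. by case/den_unit=> t td dx; rewrite -[x]scale1r -td -scalerA dx scaler0. Qed.

Lemma den_injM d (x : A) : den d -> d * x = 0 -> x = 0.
Proof. by case/den_unit=> t td dx; rewrite -[x]mul1r -td -mulrA dx mulr0. Qed.

Lemma latN x : lat x -> lat (fun k => - x k).
Proof.
move=> Lx; have -> : (fun k => - x k) = (fun k => - 1 *: x k).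
  by apply/funext => k; rewrite scaleN1r.
by apply: latZ Lx; apply: scalN; apply: scal_den; apply: den1.
Qed.

Lemma smult_frac s x : den s -> smult s x -> fractional x.
Proof.
move=> Ss [z Lz ->]; exists 1; first exact: den1.
apply: (latZ (c := fun=> 1)); first exact/scal_den/den1.
by apply: latZ Lz; apply: scal_den.
Qed.

Lemma smultN s x : smult s x -> smult s (fun k => - x k).
Proof.
move=> [z Lz ->]; exists (fun k => - z k); first exact: latN.
by apply/funext => k; rewrite scalerN.
Qed.

Lemma fractionalN x : fractional x -> fractional (fun k => - x k).
Proof.
move=> [d Sd Lx]; exists d => //.
have -> : (fun k => d *: - x k) = (fun k => - (d *: x k)).
  by apply/funext => k; rewrite scalerN.
exact: latN.
Qed.

Lemma fractional_orth b x k : fractional x -> B (e b) (x k) = 0.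
Proof.
move=> [d Sd Lx]; apply: den_injM Sd _.
by have := lat_orth b k Lx; rewrite (polarZr qP).
Qed.

Lemma fractional_orthC b x k : fractional x -> B (x k) (e b) = 0.
Proof. by move=> Fx; rewrite polarC fractional_orth. Qed.

Lemma axis_opp b : B (e b) (e (b.1, ~~ b.2)) = 1.
Proof. by rewrite axis_polar eqxx. Qed.

Lemma axis_far b c : c.1 != b.1 -> B (e b) (e c) = 0.
Proof.
by move=> bc; rewrite axis_polar; case: (c =P _) bc => // -> /=; rewrite eqxx.
Qed.

Lemma words_inv X g : (forall x, X x -> fractional x) ->
  (forall x, X x -> X (fun k => - x k)) -> words X g ->
  exists g', [/\ words X g', forall k, cancel (g k) (g' k) &
                 forall k, cancel (g' k) (g k)].
Proof.
move=> XF XN; elim=> [|b x h Xx _ [h' [Wh' hK h'K]]].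
  by exists (fun=> id); split=> //; apply: words1.
have uv k : B (e b) (x k) = 0 by apply: fractional_orth; apply: XF.
exists (h' \oo ptransv b (fun k => - x k)); split.
- by apply: words_comp => //; apply/words_gen/XN.
- move=> k y; rewrite /paircomp /ptransv /= transvNK ?hK //; exact: axis_quad.
- move=> k y; rewrite /paircomp /ptransv /= h'K transvK //; exact: axis_quad.
Qed.

Lemma words_conj X Y h h' g : (forall k, cancel (h k) (h' k)) ->
  (forall k, cancel (h' k) (h k)) ->
  (forall b x, X x -> words Y (h \oo ptransv b x \oo h')) ->
  words X g -> words Y (h \oo g \oo h').
Proof.
move=> hK h'K XY; elim=> [|b x f Xx _ IH].
  by apply: words_eq (words1 Y) => k y; rewrite /paircomp /= h'K.
apply: words_eq (words_comp (XY b x Xx) IH) => k y.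
by rewrite /paircomp /= hK.
Qed.

(** Conjugation by an isometry applies it to both vectors of a transvection;
    here the isometry fixes the axis e c. *)
Lemma transv_axis_conj b c x y : (forall k, B (e b) (x k) = 0) ->
    c.1 != b.1 -> (forall k, B (x k) (e c) = 0) ->
  ptransv b x \oo ptransv c y \oo ptransv b (fun k => - x k) =
  ptransv c (fun k => ptransv b x k (y k)).
Proof.
move=> bx cb xc; apply/funext => k; apply/funext => z.
rewrite /paircomp /ptransv /=.
rewrite (transv_conj _ _ _ (transv_linear qP _ _)); last first.
  by move=> w; apply: quad_transv; rewrite ?axis_quad.
rewrite transvK ?axis_quad //; congr transv.
rewrite {1}/transv axis_far // xc mulr0 addr0 !scale0r subr0 addr0 //.
Qed.

(** The transvection of e c and x maps y to y - <x,y> e c, so the commutator of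
    the transvections (e c, x) and (e b, - y) is the one stated. *)
Lemma commutator_mem X b c x y : (forall x, X x -> fractional x) ->
    (forall x, X x -> X (fun k => - x k)) -> c.1 != b.1 -> X x -> X y ->
  words X (ptransv b (fun k => B (x k) (y k) *: e c)).
Proof.
move=> XF XN cb Xx Xy; have bc : b.1 != c.1 by rewrite eq_sym.
have Fx := XF _ Xx; have Fy := XF _ Xy.
apply: words_eq (words_comp (words_comp (words_gen c Xx) (words_gen b (XN _ Xy)))
  (words_comp (words_gen c (XN _ Xx)) (words_gen b Xy))).
move=> k z; rewrite /paircomp /=.
have /(congr1 (fun f => f k (ptransv b y k z))) :=
  @transv_axis_conj c b x (fun k => - y k) (fun k => fractional_orth c k Fx) bc
    (fun k => fractional_orthC b k Fx).
rewrite /paircomp /= => ->; rewrite /ptransv.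
have tr_y : transv q (e c) (x k) (- y k) = - y k + B (x k) (y k) *: e c.
  rewrite /transv !(polarNr qP) (fractional_orth _ _ Fy) oppr0 mulr0 addr0.
  by rewrite scale0r add0r scaleNr opprK.
rewrite tr_y transvD ?axis_quad ?(fractional_orth _ _ Fy) //; last first.
  by rewrite !(polarE qP) (fractional_orth _ _ Fy) axis_far // mulr0 oppr0 addr0.
by rewrite addrAC addNr add0r.
Qed.

Section Level.
Variable s : A.
Hypothesis Ss : den s.

Lemma long_mem b c a : scal a -> c.1 != b.1 ->
  words (smult s) (ptransv b (fun k => (s ^+ 2 * d0 ^+ 2 * a k) *: e c)).
Proof.
move=> Da cb.
pose x : bool -> V := fun=> s *: (d0 *: vv D).
pose y : bool -> V := fun k => s *: (a k *: (d0 *: ww D)).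
have Lx : smult s x by exists (fun=> d0 *: vv D) => //; apply: lat_vv.
have Ly : smult s y.
  by exists (fun k => a k *: (d0 *: ww D)) => //; apply: latZ (lat_ww D).
have XF z : smult s z -> fractional z by apply: smult_frac.
apply: words_eq (commutator_mem XF (@smultN s) cb Lx Ly) => k z.
by congr (transv _ _ (_ *: _)); rewrite /x /y !(polarE qP) vv_ww; ring.
Qed.

Variable d : A.
Hypothesis Sd : den d.
(** The factor s ^+ 2 * d0 ^+ 2 is the price of a commutator, and d ^+ 2 clears
    the denominators of q (x k) when d clears those of x. *)
Definition depth : A := s ^+ 2 * d0 ^+ 2 * d ^+ 2.

Lemma den_exp a n : den a -> den (a ^+ n).
Proof.
move=> Sa; elim: n => [|n IH]; first by rewrite expr0; apply: den1.
by rewrite exprS; apply: denM.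
Qed.

Lemma den_depth : den depth.
Proof.
by rewrite /depth; apply: denM; [apply: denM |]; apply: den_exp => //; apply: den_dd.
Qed.

(** All transvections met after a conjugation have this form: a vector of the
    plane of c plus a vector of the lattice. *)
Lemma mix_mem b c a1 a2 x : c.1 != b.1 ->
    scal (fun k => d ^+ 2 * a1 k) -> scal (fun k => d ^+ 2 * a2 k) ->
    lat (fun k => d ^+ 2 *: x k) ->
  words (smult s) (ptransv b (fun k =>
    depth *: (a1 k *: e c + x k + a2 k *: e (c.1, ~~ c.2)))).
Proof.
move=> cb D1 D2 Lx.
have Fx : fractional x by exists (d ^+ 2) => //; apply: den_exp.
have W1 := long_mem D1 cb.
have W2 := @long_mem b (c.1, ~~ c.2) _ D2 cb.
have Wx : words (smult s) (ptransv b (fun k => depth *: x k)).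
  apply: words_gen; exists (fun k => (s * d0 ^+ 2) *: (d ^+ 2 *: x k)).
    apply: (latZ (c := fun=> s * d0 ^+ 2)) => //; apply: scal_den.
    by apply: denM => //; apply: den_exp; apply: den_dd.
  by apply/funext => k; rewrite !scalerA; congr (_ *: _); rewrite /depth; ring.
apply: words_eq (words_comp (words_comp W1 Wx) W2) => k z.
rewrite /paircomp /ptransv /= transvD ?transvD ?axis_quad //;
  rewrite ?(polarE qP) ?(fractional_orth _ _ Fx) ?axis_far ?mulr0 ?addr0 //.
by congr transv; rewrite !scalerDr !scalerA /depth !mulrA.
Qed.

Section Conjugate.
Variables (b : idx) (x : bool -> V).
Hypothesis Lx : lat (fun k => d *: x k).
Local Notation b' := (b.1, ~~ b.2).

Let Fx : fractional x. Proof. by exists d. Qed.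
Let Dd : scal (fun=> d). Proof. exact: scal_den. Qed.
Let Lx2 : lat (fun k => d ^+ 2 *: x k).
Proof.
have := latZ Dd Lx; congr lat.
by apply/funext => k; rewrite scalerA.
Qed.

Lemma conj_lat_mem c u z : c.1 != b.1 -> scal u -> lat z ->
  words (smult s) (ptransv c (fun k => ptransv b x k (depth *: (u k *: z k)))).
Proof.
move=> cb Du Lz.
have D1 : scal (fun k => d ^+ 2 * - (u k * B (x k) (z k))).
  have := scalN (scalM Dd (scalM Du (lat_polar Lx Lz))); congr scal.
  by apply/funext => k; rewrite (polarZl qP); ring.
have D2 : scal (fun=> d ^+ 2 * 0) by rewrite mulr0; apply: scal0.
have L3 : lat (fun k => d ^+ 2 *: (u k *: z k)).
  apply: (latZ (c := fun=> d ^+ 2)); last exact: latZ.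
  exact/scal_den/den_exp.
have bc : b.1 != c.1 by rewrite eq_sym.
apply: words_eq (mix_mem (b := c) bc D1 D2 L3) => k y.
rewrite /ptransv; congr transv.
rewrite {1}/transv !(polarE qP) (lat_orth _ _ Lz); lincomb.
Qed.

Lemma conj_opp_mem c u : c.1 != b.1 -> scal u ->
  words (smult s) (ptransv c (fun k => ptransv b x k (depth *: (u k *: e b')))).
Proof.
move=> cb Du.
have D1 : scal (fun k => d ^+ 2 * - (u k * q (x k))).
  have := scalN (scalM Du (lat_quad Lx)); congr scal.
  by apply/funext => k; rewrite (quadZ qP); ring.
have D2 : scal (fun k => d ^+ 2 * u k).
  by apply: (scalM (c := fun=> d ^+ 2)) => //; apply/scal_den/den_exp.
have L3 : lat (fun k => d ^+ 2 *: (u k *: x k)).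
  by have := latZ Du Lx2; congr lat; apply/funext => k; rewrite !scalerA mulrC.
have bc : b.1 != c.1 by rewrite eq_sym.
apply: words_eq (mix_mem (b := c) bc D1 D2 L3) => k y.
rewrite /ptransv; congr transv.
rewrite {1}/transv !(polarE qP) axis_opp (fractional_orthC _ _ Fx).
by lincomb.
Qed.

(** The point is that no axis on the right-hand side is opposite to b. Let f, f'
    be the axes of the plane of c and g the axis opposite to b. The three middle
    factors form a conjugate of the transvection of f' and w = - r z, hence are
    the transvection of f' - r g and w; by transvDl the latter is, up to the two
    outer factors, the transvection of - r g and w. *)
Lemma opp_factor (c : idx) (r : A) z : c.1 != b.1 -> (forall a k, B (e a) (z k) = 0) ->
  ptransv b' (fun k => r ^+ 2 *: z k) =
    ptransv (c.1, ~~ c.2) (fun k => r *: (1 *: z k))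
    \oo (ptransv c (fun k => r *: (- 1 *: e b'))
    \oo (ptransv (c.1, ~~ c.2) (fun k => r *: (- 1 *: z k))
    \oo (ptransv c (fun k => r *: (1 *: e b'))
    \oo ptransv (c.1, ~~ c.2) (fun k => r *: (- (r ^+ 2 * q (z k)) *: e b'))))).
Proof.
move=> cb ez; have bc : b.1 != c.1 by rewrite eq_sym.
apply/funext => k; apply/funext => y; rewrite /paircomp /ptransv /=.
set f := e c; set f' := e (c.1, ~~ c.2); set g := e b'.
have [w we] : exists w, w = - (r *: z k) by exists (- (r *: z k)).
have qf : q f = 0 := axis_quad (l := D) c.
have qf' : q f' = 0 := axis_quad (l := D) (c.1, ~~ c.2).
have qg : q g = 0 := axis_quad (l := D) b'.
have gf : B g f = 0 by apply: axis_far.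
have gf' : B g f' = 0 by apply: axis_far.
have fg : B f g = 0 by apply: axis_far.
have f'g : B f' g = 0 by apply: axis_far.
have ff' : B f f' = 1 by apply: axis_opp.
have gw : B g w = 0 by rewrite we (polarNr qP) (polarZr qP) ez mulr0 oppr0.
have fw : B f w = 0 by rewrite we (polarNr qP) (polarZr qP) ez mulr0 oppr0.
have f'w : B f' w = 0 by rewrite we (polarNr qP) (polarZr qP) ez mulr0 oppr0.
have -> : r *: (1 *: z k) = - w by rewrite we opprK scale1r.
have -> : r *: (- 1 *: z k) = w by rewrite we scaleN1r scalerN.
have -> : r *: (1 *: g) = r *: g by rewrite scale1r.
have -> : r *: (- 1 *: g) = - (r *: g) by rewrite scaleN1r scalerN.
have qw : q w = r ^+ 2 * q (z k) by rewrite we (quadN qP) (quadZ qP).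
rewrite -qw; set y5 := transv q f' _ y.
have e1 y0 : transv q f (- (r *: g)) (transv q f' w (transv q f (r *: g) y0)) =
    transv q (f' - r *: g) w y0.
  rewrite (transv_conj _ _ _ (transv_linear qP _ _)); last first.
    by move=> v; rewrite quad_transv // (polarNr qP) (polarZr qP) fg mulr0 oppr0.
  rewrite (transvNK qP) ?qf //; last by rewrite (polarZr qP) fg mulr0.
  congr transv; rewrite /transv !(polarE qP) (quadN qP) (quadZ qP) ?ff' ?gf' ?fw ?gw qg;
    lincomb.
rewrite e1 -scaleNr (transvDl qP) ?(quadZ qP) ?qg ?(polarE qP) ?f'g ?gw ?mulr0 //.
rewrite (transvNK qP) // (transvZ qP).
have -> : transv q f' (- (q w *: (- r *: g))) y5 = y.
  rewrite /y5 (transvD qP) ?(polarE qP) ?f'g ?mulr0 ?oppr0 //.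
  by rewrite scalerA scalerA mulrN scaleNr opprK mulrN scaleNr [q w * r]mulrC subrr (transv0 qP).
by rewrite we scalerN scaleNr opprK scalerA.
Qed.

(** The key step. The conjugation fixes an axis in another hyperbolic plane and
    only changes the vector that goes with it. A transvection with the opposite
    axis is first factored by opp_factor, with r = depth, which is why the factor
    depth is needed twice. *)
Lemma conj_mem g : words (smult (depth ^+ 2)) g ->
  words (smult s) (ptransv b x \oo g \oo ptransv b (fun k => - x k)).
Proof.
have xK k : cancel (ptransv b (fun k => - x k) k) (ptransv b x k).
  by apply: transvK; rewrite ?axis_quad ?(fractional_orth _ _ Fx).
have xNK k : cancel (ptransv b x k) (ptransv b (fun k => - x k) k).
  by apply: transvNK; rewrite ?axis_quad ?(fractional_orth _ _ Fx).
have Sr := den_depth; have Dr := scal_den Sr.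
have D1 : scal (fun=> 1) by apply/scal_den/den1.
have conjE c y : c.1 != b.1 ->
    ptransv b x \oo ptransv c y \oo ptransv b (fun k => - x k) =
    ptransv c (fun k => ptransv b x k (y k)).
  move=> cb; apply: transv_axis_conj => // k; first exact: fractional_orth.
  exact: fractional_orthC.
have conjM g1 g2 : ptransv b x \oo (g1 \oo g2) \oo ptransv b (fun k => - x k) =
    (ptransv b x \oo g1 \oo ptransv b (fun k => - x k)) \oo
    (ptransv b x \oo g2 \oo ptransv b (fun k => - x k)).
  by apply/funext => k; apply/funext => y; rewrite /paircomp /= xNK.
apply: words_conj => // c _ [z Lz ->].
have [cb|cb] := eqVneq c.1 b.1; last first.
  rewrite conjE //; apply: words_eq (conj_lat_mem cb Dr Lz) => k y.
  by rewrite /ptransv scalerA.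
have [cb2|cb2] := eqVneq c.2 b.2.
  have -> : c = b by case: (c) (b) cb cb2 => i1 s1 [i2 s2] /= -> ->.
  have Lrz : smult s (fun k => depth ^+ 2 *: z k).
    exists (fun k => (depth * (s * d0 ^+ 2 * d ^+ 2)) *: z k).
      apply: (latZ (c := fun=> _) _ Lz); apply: scal_den; apply: denM => //.
      apply: denM; [apply: denM => // | exact: den_exp].
      by apply: den_exp; apply: den_dd.
    apply/funext => k; rewrite scalerA; congr (_ *: _).
    by rewrite /depth; ring.
  apply: words_eq (words_gen b Lrz) => k y.
  have Frz := smult_frac Ss Lrz.
  rewrite /paircomp /ptransv /= !transvD ?axis_quad //;
    rewrite ?(polarE qP) ?(fractional_orth _ _ Fx) ?(lat_orth _ _ Lz) ?mulr0 ?oppr0 ?addr0 //.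
  by rewrite addrAC subrr add0r.
have -> : c = b'.
  by case: (c) (b) cb cb2 => i1 s1 [i2 s2] /= ->; case: s1 s2 => [] [].
have [j jb] : exists j, j != b.1.
  have := wrank_gt1 D; case: (wrank D) (b) => [|[|n]] [i ?] // _.
  have [->|] := eqVneq i ord0; last by exists ord0; rewrite eq_sym.
  by exists ord_max.
have cb1 : (j, true).1 != b.1 by [].
rewrite (opp_factor depth cb1); last by move=> a k; apply: lat_orth.
rewrite 4!conjM !conjE //.
apply: words_comp; first exact: conj_lat_mem.
apply: words_comp; first by apply: (conj_opp_mem (u := fun=> -1)) => //; apply: scalN.
apply: words_comp; first by apply: (conj_lat_mem (u := fun=> -1)) => //; apply: scalN.
apply: words_comp; first exact: conj_opp_mem.
apply: conj_opp_mem => //; apply: scalN; apply: scalM; last exact: lat_quad.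
exact/scal_den/den_exp.
Qed.

End Conjugate.
End Level.

Section EichlerWords.
Variable h : A.
Hypothesis h2 : 2%:R * h = 1.
Hypothesis Dh : scal (fun=> h).

Lemma fractionalZ (a : bool -> A) d x : den d -> scal (fun k => d * a k) -> fractional x ->
  fractional (fun k => a k *: x k).
Proof.
move=> Sd Da [d' Sd' Lx]; exists (d * d'); first exact: denM.
have := latZ Da Lx; congr lat; apply/funext => k.
by rewrite !scalerA; congr (_ *: _); ring.
Qed.

Lemma plane_mem b c x y : fractional x -> fractional y -> c.1 != b.1 ->
  words fractional (ptransv b (fun k => (h * B (x k) (y k)) *: e c)).
Proof.
move=> Fx Fy cb.
have Fhx : fractional (fun k => h *: x k).
  apply: fractionalZ (den1 D) _ Fx.
  by apply: (scalM (c := fun=> 1) (d := fun=> h)) => //; apply/scal_den/den1.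
apply: words_eq (commutator_mem (fun=> id) fractionalN cb Fhx Fy) => k z.
by rewrite /ptransv (polarZl qP).
Qed.

(** By eichler_cons, each pair contributes a transvection along its own axis,
    corrected by transvections in the planes of that axis and the later ones. *)
Lemma eichler_mem (u : bool) (z : 'I_(wrank D) -> bool -> V) r : uniq r ->
    (forall i, fractional (z i)) ->
  words fractional (fun k => eichler q h [seq (e (i, u), z i k) | i <- r]).
Proof.
move=> + Fz; elim: r => [_|i r IH] /=.
  by apply: words_eq (words1 _) => k y; rewrite /= eichler_nil.
move=> /andP[ir ur].
have ee a c : B (e (a, u)) (e (c, u)) = 0.
  by rewrite axis_polar; case: eqP => //= -[_]; case: (u).
have W1 : words fractional (ptransv (i, u) (fun k => - z i k)).
  by apply/words_gen/fractionalN.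
have W2 : words fractional (ptransv (i, u) (fun k =>
    - (h *: upper q [seq (e (j, u), z j k) | j <- r] (z i k)))).
  elim: r ir {IH ur} => [|j r IH].
    move=> _; apply: words_eq (words1 _) => k y.
    by rewrite /ptransv /upper big_nil scaler0 oppr0 transv0.
  rewrite inE negb_or => /andP[ij ir].
  have ji : (j, u).1 != (i, u).1 by rewrite eq_sym.
  apply: words_eq (words_comp (plane_mem (fractionalN (Fz j)) (Fz i) ji) (IH ir)) => k y.
  rewrite /paircomp /ptransv /= upper_cons /= transvD ?axis_quad //.
  - by congr transv; rewrite (polarNl qP); lincomb.
  - by rewrite (polarZr qP) ee mulr0.
  - rewrite (polarNr qP) (polarZr qP) polar_upper // big_map big1 ?mulr0 ?oppr0 //.
    by move=> c _; rewrite ee mulr0.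
apply: words_eq (words_comp (words_comp W1 W2) (IH ur)) => k y.
rewrite /paircomp /ptransv /= eichler_cons ?axis_quad ?(fractional_orth _ _ (Fz i)) //.
- rewrite transvD ?axis_quad -?opprD // ?(polarE qP) ?(fractional_orth _ _ (Fz i)) ?oppr0 //.
  rewrite polar_upper // big_map big1 ?mulr0 ?oppr0 // => c _.
  by rewrite ee mulr0.
- move=> _ /mapP[j _ ->] /=; rewrite ee (fractional_orth _ _ (Fz j)); split=> //.
  by rewrite (fractional_orthC _ _ (Fz i)).
- by move=> _ _ /mapP[j _ ->] /mapP[j' _ ->] /=; rewrite ee (fractional_orth _ _ (Fz j')).
Qed.

End EichlerWords.

End Words.

(** * Substitutions and constant frames *)

Section Rescale.
Variable k : comNzRingType.
Implicit Types (p r : {poly k}) (a b c t : k).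

Definition rescale b p : {poly k} := p \Po (b%:P * 'X).

Lemma rescaleC b c : rescale b c%:P = c%:P.
Proof. exact: comp_polyC. Qed.
Lemma rescaleD b p r : rescale b (p + r) = rescale b p + rescale b r.
Proof. exact: comp_polyD. Qed.
Lemma rescaleM b p r : rescale b (p * r) = rescale b p * rescale b r.
Proof. exact: comp_polyM. Qed.
Lemma rescale0 b : rescale b 0 = 0.
Proof. exact: comp_poly0. Qed.
Lemma rescaleB b p r : rescale b (p - r) = rescale b p - rescale b r.
Proof. exact: comp_polyB. Qed.
Lemma rescale_sum b I (s : seq I) (P : pred I) (F : I -> {poly k}) :
  rescale b (\sum_(i <- s | P i) F i) = \sum_(i <- s | P i) rescale b (F i).
Proof. exact: (big_morph (rescale b) (rescaleD b) (rescale0 b)). Qed.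

Lemma rescale_1 p : rescale 1 p = p.
Proof. by rewrite /rescale mul1r comp_polyXr. Qed.
Lemma rescale_0 p : rescale 0 p = (p.[0])%:P.
Proof. by rewrite /rescale mul0r comp_poly0r horner_coef0. Qed.

Lemma rescale_shift b t c p :
  exists r, rescale (b + t * c) p = rescale b p + t%:P * r.
Proof.
elim/poly_ind: p => [|p a [r IH]].
  by exists 0; rewrite !rescale0 mulr0 addr0.
exists (rescale b p * (c%:P * 'X) + r * ((b + t * c)%:P * 'X)).
rewrite /rescale !comp_poly_MXaddC -!/(rescale _ p) IH polyCD polyCM; ring.
Qed.

End Rescale.

Lemma linear0f (A : comNzRingType) (V W : lmodType A) (g : V -> W) :
  linear g -> g 0 = 0.
Proof. by move=> glin; have := glin (-1) 0 0; rewrite scaler0 addr0 scaleN1r addNr. Qed.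

Lemma linearZf (A : comNzRingType) (V W : lmodType A) (g : V -> W) a x :
  linear g -> g (a *: x) = a *: g x.
Proof. by move=> glin; have := glin a x 0; rewrite (linear0f glin) !addr0. Qed.

Lemma linearDf (A : comNzRingType) (V W : lmodType A) (g : V -> W) x y :
  linear g -> g (x + y) = g x + g y.
Proof. by move=> glin; have := glin 1 x y; rewrite !scale1r. Qed.

Lemma linearNf (A : comNzRingType) (V W : lmodType A) (g : V -> W) x :
  linear g -> g (- x) = - g x.
Proof. by move=> glin; rewrite -scaleN1r linearZf // scaleN1r. Qed.

Lemma linear_combf (A : comNzRingType) (V W : lmodType A) (g : V -> W)
    I (r : seq I) (a : I -> A) (F : I -> V) : linear g ->
  g (\sum_(i <- r) a i *: F i) = \sum_(i <- r) a i *: g (F i).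
Proof.
move=> glin; rewrite (big_morph g (fun x y => linearDf x y glin) (linear0f glin)).
by apply: eq_bigr => i _; rewrite linearZf.
Qed.

(** A finite generating family with dual coordinates, all of whose products and
    coordinates are constant polynomials: what remains of a basis for a module
    extended from a projective module over k. *)
Record frame (k : comNzRingType) (W : lmodType {poly k}) (q : W -> {poly k}) := Frame {
  frame_index : finType;
  fvec : frame_index -> W;
  fcoord : frame_index -> W -> {poly k};
  fcoord_scalar i : scalar (fcoord i);
  frameE y : y = \sum_i fcoord i y *: fvec i;
  fcoord_const i j : exists c, fcoord i (fvec j) = c%:P;
  fpolar_const i j : exists c, polar q (fvec i) (fvec j) = c%:P }.

Arguments frameE {k W q} f y.
Arguments fcoord_const {k W q} f i j.
Arguments fpolar_const {k W q} f i j.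

Section Twist.
Variables (k : comNzRingType) (W : lmodType {poly k}) (q : W -> {poly k}).
Hypothesis qP : is_quadratic q.
Variables (half : k) (F : frame q).
Hypothesis half2 : 2%:R * half = 1.
Local Notation B := (polar q).
Local Notation w := (@fvec _ _ _ F).
Local Notation th := (@fcoord _ _ _ F).
Implicit Types (g h : W -> W) (b c t : k).

Lemma fcoordZD i a x y : th i (a *: x + y) = a * th i x + th i y.
Proof. exact: (fcoord_scalar i). Qed.
Lemma fcoord0 i : th i 0 = 0.
Proof. by have := fcoordZD i (-1) 0 0; rewrite scaler0 addr0 mulN1r addNr. Qed.
Lemma fcoordD i x y : th i (x + y) = th i x + th i y.
Proof. by rewrite -[x in LHS]scale1r fcoordZD mul1r. Qed.
Lemma fcoordZ i a x : th i (a *: x) = a * th i x.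
Proof. by rewrite -[a *: x]addr0 fcoordZD fcoord0 addr0. Qed.
Lemma fcoord_sum i I (s : seq I) (G : I -> W) :
  th i (\sum_(j <- s) G j) = \sum_(j <- s) th i (G j).
Proof. exact: (big_morph (th i) (fcoordD i) (fcoord0 i)). Qed.

Lemma linear_ext (W' : lmodType {poly k}) (g h : W -> W') : linear g -> linear h ->
  (forall i, g (w i) = h (w i)) -> g =1 h.
Proof.
move=> gl hl gh y; rewrite [y](frameE F) (linear_combf _ _ _ gl) (linear_combf _ _ _ hl).
by apply: eq_bigr => i _; rewrite gh.
Qed.

(** The substitution of b X for X on a module with a constant frame. *)
Definition frescale b (y : W) : W := \sum_i rescale b (th i y) *: w i.

Lemma frescaleZD b a x y :
  frescale b (a *: x + y) = rescale b a *: frescale b x + frescale b y.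
Proof.
rewrite /frescale scaler_sumr -big_split; apply: eq_bigr => i _ /=.
by rewrite fcoordZD rescaleD rescaleM scalerDl scalerA.
Qed.
Lemma frescale0 b : frescale b 0 = 0.
Proof. by apply: big1 => i _; rewrite fcoord0 rescale0 scale0r. Qed.
Lemma frescaleZ b a x : frescale b (a *: x) = rescale b a *: frescale b x.
Proof. by rewrite -[a *: x]addr0 frescaleZD frescale0 addr0. Qed.
Lemma frescaleD b x y : frescale b (x + y) = frescale b x + frescale b y.
Proof.
by rewrite -[x in LHS]scale1r frescaleZD (rescaleC b 1) scale1r.
Qed.
Lemma frescaleN b x : frescale b (- x) = - frescale b x.
Proof. by apply: (addrI (frescale b x)); rewrite -frescaleD !subrr frescale0. Qed.
Lemma frescaleB b x y : frescale b (x - y) = frescale b x - frescale b y.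
Proof. by rewrite frescaleD frescaleN. Qed.
Lemma frescale_sum b I (s : seq I) (G : I -> W) :
  frescale b (\sum_(j <- s) G j) = \sum_(j <- s) frescale b (G j).
Proof. exact: (big_morph (frescale b) (frescaleD b) (frescale0 b)). Qed.

Lemma frescale_fvec b i : frescale b (w i) = w i.
Proof.
rewrite [RHS](frameE F); apply: eq_bigr => j _.
by have [c ->] := fcoord_const F j i; rewrite rescaleC.
Qed.

Lemma fcoord_frescale b i y : th i (frescale b y) = rescale b (th i y).
Proof.
rewrite [in RHS](frameE F y) /frescale !fcoord_sum rescale_sum.
apply: eq_bigr => j _; rewrite !fcoordZ rescaleM.
by have [c ->] := fcoord_const F i j; rewrite rescaleC.
Qed.

Lemma polar_frescale b x y : B (frescale b x) (frescale b y) = rescale b (B x y).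
Proof.
rewrite [in RHS](frameE F x) [in RHS](frameE F y) /frescale.
rewrite !(polar_suml qP) rescale_sum; apply: eq_bigr => i _.
rewrite !(polar_sumr qP) rescale_sum; apply: eq_bigr => j _.
rewrite !(polarE qP) !rescaleM; have [c ->] := fpolar_const F i j.
by rewrite rescaleC.
Qed.

Lemma quad_frescale b y : q (frescale b y) = rescale b (q y).
Proof.
have h2 : 2%:R * half%:P = 1 :> {poly k} by rewrite -polyC_natr -polyCM half2.
by rewrite !(quad_half qP h2) rescaleM rescaleC polar_frescale.
Qed.

Lemma frescale_transv b u v y :
  frescale b (transv q u v y) = transv q (frescale b u) (frescale b v) (frescale b y).
Proof.
rewrite /transv !polar_frescale quad_frescale frescaleD frescaleB !frescaleZ.
by rewrite (rescaleD b (B v y)) rescaleM.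
Qed.

Lemma frescale_1 y : frescale 1 y = y.
Proof.
by rewrite [RHS](frameE F); apply: eq_bigr => i _; rewrite rescale_1.
Qed.

(** The base change of the linear map g along the substitution of b X for X. *)
Definition twist b g (y : W) : W := \sum_i th i y *: frescale b (g (w i)).

Lemma twist_linear b g : linear (twist b g).
Proof.
move=> a x y; rewrite /twist scaler_sumr -big_split; apply: eq_bigr => i _ /=.
by rewrite fcoordZD scalerDl scalerA.
Qed.

Lemma twist_frescale b g y : linear g ->
  twist b g (frescale b y) = frescale b (g y).
Proof.
move=> gl; rewrite [in RHS](frameE F y) (linear_combf _ _ _ gl) frescale_sum.
by apply: eq_bigr => i _; rewrite fcoord_frescale frescaleZ.
Qed.

(** The substitution fixes the vectors of the frame, and a linear map is
    determined by its values on them. *)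
Lemma twistP b g h : linear g -> linear h ->
  (forall y, h (frescale b y) = frescale b (g y)) -> twist b g =1 h.
Proof.
move=> gl hl gh; apply: linear_ext => // [|i]; first exact: twist_linear.
by rewrite -[w i](frescale_fvec b) twist_frescale // gh.
Qed.

Lemma twist_id b : twist b id =1 id.
Proof. exact: twistP. Qed.

Lemma linear_comp g h : linear g -> linear h -> linear (g \o h).
Proof. by move=> gl hl a x y /=; rewrite hl gl. Qed.

Lemma twist_comp b g h : linear g -> linear h ->
  twist b (g \o h) =1 twist b g \o twist b h.
Proof.
move=> gl hl; apply: twistP => [||y]; first exact: linear_comp.
  by apply: linear_comp; apply: twist_linear.
by rewrite /= !twist_frescale.
Qed.

Lemma twist_transv b u v :
  twist b (transv q u v) =1 transv q (frescale b u) (frescale b v).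
Proof.
by apply: twistP => [||y]; rewrite ?frescale_transv //; apply: transv_linear.
Qed.

Lemma twist_1 g : linear g -> twist 1 g =1 g.
Proof. by move=> gl; apply: twistP => // y; rewrite !frescale_1. Qed.

Lemma frescale_shift b t c y :
  exists z, frescale (b + t * c) y = frescale b y + t%:P *: z.
Proof.
have [r rE] := choice (fun i => rescale_shift b t c (th i y)).
exists (\sum_i r i *: w i); rewrite /frescale scaler_sumr -big_split.
by apply: eq_bigr => i _; rewrite rE scalerDl scalerA.
Qed.

Lemma twist_shift b t c g y :
  exists z, twist (b + t * c) g y = twist b g y + t%:P *: z.
Proof.
have [z zE] := choice (fun i => frescale_shift b t c (g (w i))).
exists (\sum_i th i y *: z i); rewrite /twist scaler_sumr -big_split.
by apply: eq_bigr => i _; rewrite zE scalerDr !scalerA mulrC.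
Qed.

(** In what follows P is the set of the admissible values b in the substitution
    of b X for X: the elements defined before localization. *)
Section Shift.
Variables (D : lattice q) (P : k -> Prop).
Local Notation den := (den D).
Local Notation lat := (lat D).
Local Notation words := (@words _ _ _ D).
Local Notation fractional := (@fractional _ _ _ D).
Local Notation smult := (@smult _ _ _ D).
Hypothesis denC : forall s, den s -> exists2 t, P t & s = t%:P.
Hypothesis PM : forall t c, P t -> P c -> P (t * c).
Hypothesis PD : forall t c, P t -> P c -> P (t + c).
Hypothesis axisC : forall b a, frescale b (axis D a) = axis D a.
Hypothesis latR : forall b x, P b -> lat x -> lat (fun n => frescale b (x n)).
Hypothesis lat_shift : forall b t c x, P b -> P t -> P c -> lat x ->
  exists2 z, lat z & forall n,
    frescale (b + t * c) (x n) = frescale b (x n) + t%:P *: z n.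

Lemma words_linear X (g : bool -> W -> W) n : words X g -> linear (g n).
Proof.
move=> Wg; elim: Wg => {g} [|b x g _ _ IH] //; apply: linear_comp => //.
exact: transv_linear.
Qed.

(** Denoting by a prime the value at b + t c, one has for a transvection T and
    a word g that T' g' (T g)^-1 is the product of T' T^-1 and of the conjugate
    of g' g^-1 by T. The first factor is divisible because the vectors of T and
    T' differ by a divisible vector. The second one is controlled by conj_mem,
    uniformly in b since the substitution does not change the denominator d of
    the vector of T. *)
Lemma words_shift (g : bool -> W -> W) : words fractional g -> exists g' : bool -> W -> W,
  [/\ words fractional g', forall n, cancel (g n) (g' n),
      forall n, cancel (g' n) (g n) &
      forall s, den s -> exists2 t, den t%:P & forall b c, P b -> P c ->
        words (smult s)
          (fun n => twist (b + t * c) (g n) \o twist b (g' n))].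
Proof.
elim=> {g} [|a x g Fx Wg [g' [Wg' gK g'K IH]]].
  exists (fun=> id); split=> // [|s Ss]; first exact: words1.
  exists 1; first exact: den1.
  move=> b c _ _; apply: words_eq (words1 D _) => n y /=.
  by rewrite !twist_id.
have ex n : polar q (axis D a) (x n) = 0 by apply: (fractional_orth qP).
have eNx n : polar q (axis D a) (- x n) = 0 by rewrite (polarNr qP) ex oppr0.
pose T := ptransv a x; pose T' := ptransv a (fun n => - x n).
have TK n : cancel (T n) (T' n) by apply: (transvNK qP) => //; apply: axis_quad.
have T'K n : cancel (T' n) (T n) by apply: (transvK qP) => //; apply: axis_quad.
exists (paircomp g' T'); split.
- by apply: words_comp => //; apply/words_gen/fractionalN.
- by move=> n y; rewrite /paircomp /= TK gK.
- by move=> n y; rewrite /paircomp /= g'K; apply: T'K.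
move=> s Ss; have [d Sd Lx] := Fx.
have Sr := den_depth Ss Sd.
have [t1 St1 H1] := IH _ (den_exp (D := D) 2 Sr).
have [sd Psd sdE] := denC (denM Ss Sd).
have [t1' Pt1' /polyC_inj t1E] := denC St1.
exists (sd * t1); first by rewrite polyCM -sdE; apply: denM => //; apply: denM.
move=> b c Pb Pc; set b' := b + _.
have bE : b' = b + t1 * (sd * c) by rewrite /b'; ring.
have Pb' : P b' by rewrite /b' t1E; apply: PD => //; do !apply: PM.
have [z Lz zE] := lat_shift Pb (PM Psd Pt1') Pc Lx.
have Lbx : lat (fun n => d *: frescale b (x n)).
  have := latR Pb Lx; congr lat; apply/funext => n.
  by have [d' _ dE] := denC Sd; rewrite frescaleZ dE rescaleC.
have := conj_mem qP Ss Sd a Lbx (H1 b (sd * c) Pb (PM Psd Pc)).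
rewrite -bE => W1.
have diff n : frescale b' (x n) = frescale b (x n) + s *: (t1%:P *: z n).
  apply/eqP; rewrite -subr_eq0; apply/eqP; apply: (den_inj (D := D) Sd).
  have := zE n; rewrite -t1E -/b'.
  have [d' _ dE] := denC Sd; rewrite !frescaleZ {1 2}dE !rescaleC -dE polyCM -sdE.
  rewrite scalerBr scalerDr => ->; apply/eqP; rewrite subr_eq0; apply/eqP.
  by congr (_ + _); rewrite !scalerA; congr (_ *: _); ring.
have Ls : smult s (fun n => s *: (t1%:P *: z n)).
  by exists (fun n => t1%:P *: z n) => //; apply: latZ Lz; apply: scal_den.
apply: words_eq (words_comp (words_gen a Ls) W1) => n y.
have Fbx : fractional (fun n => frescale b (x n)) by exists d.
have Fs := smult_frac Ss Ls.
rewrite /paircomp /= !twist_comp /= ?twist_transv ?frescaleN ?axisC //;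
  try by [apply: transv_linear | apply: words_linear Wg | apply: words_linear Wg'].
rewrite /ptransv diff (transvD qP) ?axis_quad ?(fractional_orth qP _ _ Fbx) ?(fractional_orth qP _ _ Fs) //.
by rewrite !twist_id addrC.
Qed.

End Shift.
End Twist.

(** * Dual bases and the hyperbolic space *)

#[local] Arguments dual_fun : simpl never.

Lemma dual_funD (A : comNzRingType) (N : lmodType A) (f : dualmod N) x y :
  dual_fun f (x + y) = dual_fun f x + dual_fun f y.
Proof. exact: linearD. Qed.
Lemma dual_funZ (A : comNzRingType) (N : lmodType A) (f : dualmod N) a x :
  dual_fun f (a *: x) = a * dual_fun f x.
Proof. exact: linearZ. Qed.
Lemma dual_addE (A : comNzRingType) (N : lmodType A) (f g : dualmod N) x :
  dual_fun (f + g) x = dual_fun f x + dual_fun g x.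
Proof. by []. Qed.
Lemma dual_scaleE (A : comNzRingType) (N : lmodType A) a (f : dualmod N) x :
  dual_fun (a *: f) x = a * dual_fun f x.
Proof. by []. Qed.
Lemma dual_fun0 (A : comNzRingType) (N : lmodType A) (f : dualmod N) :
  dual_fun f 0 = 0.
Proof. exact: linear0. Qed.
Lemma dual_fun_sum (A : comNzRingType) (N : lmodType A) (f : dualmod N)
    I (r : seq I) (F : I -> N) :
  dual_fun f (\sum_(i <- r) F i) = \sum_(i <- r) dual_fun f (F i).
Proof. exact: linear_sum. Qed.
Lemma dual_sumE (A : comNzRingType) (N : lmodType A) I (r : seq I)
    (F : I -> dualmod N) x :
  dual_fun (\sum_(i <- r) F i) x = \sum_(i <- r) dual_fun (F i) x.
Proof.
exact: (big_morph (fun f : dualmod N => dual_fun f x) (fun=> (fun=> erefl)) erefl).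
Qed.

Lemma inv2P (A : comNzRingType) (h : A) : 2%:R * h = 1 -> 2%:R * inv2 A = 1.
Proof. by move=> h2; apply: (@xgetPex _ 0 (fun h : A => 2%:R * h = 1)); exists h. Qed.

Lemma inv2E (A : comNzRingType) (h : A) : 2%:R * h = 1 -> inv2 A = h.
Proof.
by move=> h2; rewrite -[inv2 A]mul1r -h2 mulrAC (inv2P h2) mul1r.
Qed.

Section DualBases.
Variables (A : comNzRingType) (N : lmodType A).

Definition dual_basis r (p : 'I_r -> N) (f : 'I_r -> dualmod N) : Prop :=
  forall x, x = \sum_k dual_fun (f k) x *: p k.

Lemma dual_basis_dual r (p : 'I_r -> N) f g : dual_basis p f ->
  g = \sum_k dual_fun g (p k) *: f k.
Proof.
move=> pf; apply: dualP => x; rewrite dual_sumE {1}[x]pf dual_fun_sum.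
by apply: eq_bigr => k _; rewrite dual_funZ mulrC.
Qed.

(** The coordinates of a splitting of the projection from a free module. *)
Lemma exists_dual_basis : finitely_generated N -> projective N ->
  exists r (p : 'I_r -> N) f, dual_basis p f.
Proof.
move=> [s sN] Nproj; pose r := size s; pose p (k : 'I_r) := nth 0 s k.
pose g0 (v : 'rV[A]_r) : N := \sum_k v 0 k *: p k.
have g0_lin : linear g0.
  move=> a u v; rewrite /g0 scaler_sumr -big_split; apply: eq_bigr => k _ /=.
  by rewrite !mxE scalerDl scalerA.
pose g : {linear 'rV[A]_r -> N} := HB.pack g0 (GRing.isLinear.Build _ _ _ _ g0 g0_lin).
have g_surj x : exists v, g v = x.
  have [l [ls ->]] := sN x.
  elim: l ls => [|[a y] l IH] ls; first by exists 0; rewrite linear0 big_nil.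
  have [c cl|v vE] := IH; first by apply: ls; rewrite inE cl orbT.
  have ys : y \in s by apply: (ls (a, y)); rewrite inE eqxx.
  have yr : (index y s < r)%N by rewrite index_mem.
  exists (a *: delta_mx 0 (Ordinal yr) + v); rewrite linearP vE big_cons /=.
  congr (_ *: _ + _); rewrite /g0 (bigD1 (Ordinal yr)) //= big1 => [|k kn].
    by rewrite mxE !eqxx scale1r addr0 /p /= nth_index.
  by rewrite mxE (negPf kn) andbF scale0r.
have [h hE] := Nproj _ _ g (idfun : {linear N -> N}) g_surj.
have f_lin k : scalar (fun x => h x 0 k).
  by move=> a x y; rewrite linearP !mxE.
pose f k : dualmod N := HB.pack (fun x => h x 0 k : A)
  (GRing.isLinear.Build _ _ _ _ (fun x => h x 0 k : A) (f_lin k)).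
by exists r, p, f => x; rewrite -[LHS]hE.
Qed.

Variable q : N -> A.

(** A dual basis whose coordinate forms are products with vectors. Like a dual
    basis, it is an identity between finitely many vectors and so survives every
    base change, whereas nondegeneracy would have to be proved anew. *)
Definition adjoint_basis r (a b : 'I_r -> N) : Prop :=
  forall z, z = \sum_k polar q (b k) z *: a k.

Lemma exists_adjoint_basis : quadratic_space q ->
  exists r (a b : 'I_r -> N), adjoint_basis a b.
Proof.
case=> Nfg Nproj _ [d [dE [d' _ dK']]].
have [r [p [f pf]]] := exists_dual_basis Nfg Nproj.
exists r, p, (fun k => d' (f k)) => z; rewrite {1}[z]pf.
by apply: eq_bigr => k _; rewrite -dE dK'.
Qed.

End DualBases.

Lemma ext_ind (A B : comNzRingType) (phi : {rmorphism A -> B}) (N : lmodType A)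
    (K : ext phi N -> Prop) :
  (forall b x y, K x -> K y -> K (b *: x + y)) -> K 0 -> (forall x, K (tens phi 1 x)) ->
  forall x, K x.
Proof.
move=> KD K0 Kt; elim/quotW => l; rewrite Defs.piE; elim: l => [|c l IH].
  by rewrite big_nil.
by rewrite big_cons -[c.1]mulr1 -scale_tens; apply: KD.
Qed.

Section ExtDual.
Variables (A B : comNzRingType) (phi : {rmorphism A -> B}) (N : lmodType A).

Lemma tens1D x y : tens phi 1 (x + y) = tens phi 1 x + tens phi 1 y :> ext phi N.
Proof. by have := tens1_semilin phi 1 x y; rewrite rmorph1 !scale1r. Qed.
Lemma tens1_0 : tens phi 1 0 = 0 :> ext phi N.
Proof. by apply: (addrI (tens phi 1 0)); rewrite -tens1D !addr0. Qed.
Lemma tens1Z a x : tens phi 1 (a *: x) = phi a *: tens phi 1 x :> ext phi N.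
Proof. by have := tens1_semilin phi a x 0; rewrite tens1_0 !addr0. Qed.
Lemma tens1_sum I (r : seq I) (F : I -> N) :
  tens phi 1 (\sum_(i <- r) F i) = \sum_(i <- r) tens phi 1 (F i) :> ext phi N.
Proof. exact: (big_morph (tens phi 1) tens1D tens1_0). Qed.

Section One.
Variable f : dualmod N.
Definition ext_dual_fun : ext phi N -> B :=
  ext_lift (W := B^o) idfun (fun x => phi (dual_fun f x)).
Lemma ext_dual_semilin0 : semilin (W := B^o) (fun a => idfun (phi a))
  (fun x => phi (dual_fun f x)).
Proof.
move=> a x y; rewrite -[LHS]/(phi (dual_fun f (a *: x + y))).
by rewrite dual_funD dual_funZ rmorphD rmorphM.
Qed.
Lemma ext_dual_scalar : scalar ext_dual_fun.
Proof. exact: (ext_lift_semilin ext_dual_semilin0). Qed.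
HB.instance Definition _ :=
  GRing.isLinear.Build B (ext phi N) B *%R ext_dual_fun ext_dual_scalar.
Definition ext_dual : dualmod (ext phi N) := (ext_dual_fun : {scalar ext phi N}).
Lemma ext_dual_tens b x : dual_fun ext_dual (tens phi b x) = b * phi (dual_fun f x).
Proof. exact: (ext_lift_tens ext_dual_semilin0). Qed.
End One.

Lemma dual_basis_ext r (p : 'I_r -> N) f : dual_basis p f ->
  dual_basis (fun k => tens phi 1 (p k)) (fun k => ext_dual (f k)).
Proof.
move=> pf; apply: ext_ind => [b x y xE yE||x].
- rewrite {1}xE {1}yE scaler_sumr -big_split; apply: eq_bigr => k _ /=.
  by rewrite dual_funD dual_funZ scalerDl scalerA.
- by rewrite big1 // => k _; rewrite dual_fun0 scale0r.
- rewrite {1}[x]pf tens1_sum; apply: eq_bigr => k _.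
  by rewrite tens1Z ext_dual_tens mul1r.
Qed.

Variable q : N -> A.
Hypothesis qP : is_quadratic q.

Lemma ext_polar_tens b x c y :
  polar (ext_quad phi q) (tens phi b x) (tens phi c y) = b * c * phi (polar q x y).
Proof. by rewrite ext_polar_pi // /pre_polar !big_seq1. Qed.

Lemma adjoint_basis_ext r (a b : 'I_r -> N) : adjoint_basis q a b ->
  adjoint_basis (ext_quad phi q) (fun k => tens phi 1 (a k)) (fun k => tens phi 1 (b k)).
Proof.
have eqP := ext_quad_quadratic phi qP.
move=> ab; apply: ext_ind => [c x y xE yE||x].
- rewrite {1}xE {1}yE scaler_sumr -big_split; apply: eq_bigr => k _ /=.
  by rewrite (polarDr eqP) (polarZr eqP) [in RHS]scalerDl scalerA.
- by rewrite big1 // => k _; rewrite (polar0r eqP) scale0r.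
- rewrite {1}[x]ab tens1_sum; apply: eq_bigr => k _.
  by rewrite tens1Z ext_polar_tens !mul1r.
Qed.

End ExtDual.

Section Hyp.
Variables (A : comNzRingType) (Q P : lmodType A) (q : Q -> A).
Hypothesis qP : is_quadratic q.
Local Notation H := (hyp Q P).
Local Notation hq := (@hyp_quad A Q P q).

Definition inQ (z : Q) : H := (z, 0, 0).
Definition inP (x : P) : H := (0, x, 0).
Definition inF (f : dualmod P) : H := (0, 0, f).

Lemma hypE (u v : H) : u.1.1 = v.1.1 -> u.1.2 = v.1.2 -> u.2 = v.2 -> u = v.
Proof. by case: u v => [[? ?] ?] [[? ?] ?] /= -> -> ->. Qed.

Lemma inQ_linear : linear inQ.
Proof. by move=> a x y; apply: hypE; rewrite /= ?scaler0 ?addr0. Qed.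
Lemma inP_linear : linear inP.
Proof. by move=> a x y; apply: hypE; rewrite /= ?scaler0 ?addr0. Qed.
Lemma inF_linear : linear inF.
Proof. by move=> a x y; apply: hypE; rewrite /= ?scaler0 ?addr0. Qed.

Lemma inQD y z : inQ (y + z) = inQ y + inQ z.
Proof. exact: linearDf inQ_linear. Qed.
Lemma inQZ a z : inQ (a *: z) = a *: inQ z.
Proof. exact: linearZf inQ_linear. Qed.
Lemma inQN z : inQ (- z) = - inQ z.
Proof. exact: linearNf inQ_linear. Qed.
Lemma inPZ a x : inP (a *: x) = a *: inP x.
Proof. exact: linearZf inP_linear. Qed.
Lemma inFZ a f : inF (a *: f) = a *: inF f.
Proof. exact: linearZf inF_linear. Qed.

Lemma polar_hypE (u v : H) : polar hq u v =
  polar q u.1.1 v.1.1 + (dual_fun u.2 v.1.2 + dual_fun v.2 u.1.2).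
Proof.
rewrite /polar /hyp_quad /= dual_funD !dual_addE; ring.
Qed.

Lemma hyp_quadratic : is_quadratic hq.
Proof.
split.
- move=> a u; rewrite /hyp_quad /= (quadZ qP) dual_funZ dual_scaleE; ring.
- move=> u a v w; rewrite !polar_hypE /= !(polarE qP) dual_funD dual_funZ
    dual_addE dual_scaleE; ring.
- move=> u a v w; rewrite !polar_hypE /= !(polarE qP) dual_funD dual_funZ
    dual_addE dual_scaleE; ring.
Qed.

Lemma quad_inQ z : hq (inQ z) = q z.
Proof. by rewrite /hyp_quad /= dual_fun0 addr0. Qed.
Lemma quad_inP x : hq (inP x) = 0.
Proof. by rewrite /hyp_quad /= (quad0 qP) add0r. Qed.
Lemma quad_inF f : hq (inF f) = 0.
Proof. by rewrite /hyp_quad /= (quad0 qP) dual_fun0 add0r. Qed.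

Lemma polar_inQ z u : polar hq (inQ z) u = polar q z u.1.1.
Proof. by rewrite polar_hypE /= dual_fun0 !addr0. Qed.
Lemma polar_inP x u : polar hq (inP x) u = dual_fun u.2 x.
Proof. by rewrite polar_hypE /= polar0l // !add0r. Qed.
Lemma polar_inF f u : polar hq (inF f) u = dual_fun f u.1.2.
Proof. by rewrite polar_hypE /= polar0l // dual_fun0 addr0 add0r. Qed.

Lemma EO_rel_conj J (g g' h : H -> H) : EO q setT g -> cancel g g' -> cancel g' g ->
  EO_rel q J h -> EO_rel q J (g \o h \o g').
Proof.
move=> Eg gK g'K; elim=> {h} [|h [g1 [g1' [h0 [Eg1 g1K g1'K Eh0 ->]]]]|h1 h2 _ IH1 _ IH2|].
- have -> : g \o id \o g' = id by apply/funext => u /=; rewrite g'K.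
  exact: generated_id.
- apply: generated_mem; exists (g \o g1), (g1' \o g'), h0; split=> //.
  + exact: generated_comp.
  + by move=> u /=; rewrite gK g1K.
  + by move=> u /=; rewrite g1'K g'K.
- have -> : g \o (h1 \o h2) \o g' = (g \o h1 \o g') \o (g \o h2 \o g').
    by apply/funext => u /=; rewrite gK.
  exact: generated_comp.
- move=> h1 h2 _ IH h1K h2K; apply: (generated_inv IH) => u /=.
    by rewrite gK h1K g'K.
  by rewrite gK h2K g'K.
Qed.

Lemma EO_sub_rel J (h : H -> H) : EO q J h -> EO_rel q J h.
Proof.
move=> Eh; apply: generated_mem; exists id, id, h; split=> //.
exact: generated_id.
Qed.

Section Elementary.
Hypothesis two : 2%:R * inv2 A = 1.

Lemma eichler_alpha r (p : 'I_r -> P) f (al : {linear Q -> P})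
    (al' : {linear dualmod P -> Q}) : dual_basis p f ->
    (forall g z, polar q (al' g) z = dual_fun g (al z)) ->
  eichler hq (inv2 A) [seq (inP (p i), inQ (al' (f i))) | i <- enum 'I_r] =1
  E_alpha al al'.
Proof.
move=> pf adj u; set l := map _ _.
have lowE v : lower hq l v = inQ (al' v.2).
  rewrite [v.2 in RHS](dual_basis_dual _ pf) linear_sum /=.
  rewrite /lower big_map big_enum (big_morph inQ (fun x y => linearDf x y inQ_linear) (linear0f inQ_linear)).
  by apply: eq_bigr => i _; rewrite polar_inP linearZ linearZf //; apply: inQ_linear.
have upE v : upper hq l v = inP (al v.1.1).
  rewrite [al _ in RHS]pf.
  rewrite /upper big_map big_enum (linear_combf _ _ _ inP_linear).
  by apply: eq_bigr => i _; rewrite polar_inQ adj.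
rewrite /eichler lowE !upE /E_alpha.
by case: u => [[z x] g]; apply: hypE; rewrite /= ?oppr0 ?scaler0 ?oppr0 ?addr0.
Qed.

Lemma eichler_beta r (p : 'I_r -> P) f (be : {linear Q -> dualmod P})
    (be' : {linear P -> Q}) : dual_basis p f ->
    (forall x z, polar q (be' x) z = dual_fun (be z) x) ->
  eichler hq (inv2 A) [seq (inF (f i), inQ (be' (p i))) | i <- enum 'I_r] =1
  E_beta be be'.
Proof.
move=> pf adj u; set l := map _ _.
have lowE v : lower hq l v = inQ (be' v.1.2).
  rewrite [v.1.2 in RHS]pf linear_sum /=.
  rewrite /lower big_map big_enum (big_morph inQ (fun x y => linearDf x y inQ_linear) (linear0f inQ_linear)).
  by apply: eq_bigr => i _; rewrite polar_inF linearZ linearZf //; apply: inQ_linear.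
have upE v : upper hq l v = inF (be v.1.1).
  rewrite [be _ in RHS](dual_basis_dual _ pf).
  rewrite /upper big_map big_enum (linear_combf _ _ _ inF_linear).
  by apply: eq_bigr => i _; rewrite polar_inQ adj.
rewrite /eichler lowE !upE /E_beta.
case: u => [[z x] g]; apply: hypE; rewrite /= ?oppr0 ?scaler0 ?oppr0 ?addr0 //.
by rewrite [RHS]addrC addrA.
Qed.

Lemma ideal_mulZ (N : lmodType A) (J : set A) a x : J a -> ideal_mul N J (a *: x).
Proof.
move=> Ja; exists [:: (1, a *: x)]; rewrite big_seq1 scale1r; split=> // c.
by rewrite inE => /eqP ->; exists a, x.
Qed.

Lemma transv_elementary_P (J : set A) x w : (forall z, J (polar q w z)) ->
  (forall a, J a -> J (- a)) -> elementary q J (transv hq (inP x) (inQ w)).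
Proof.
move=> Jw JN.
have al_lin : linear (fun z => - polar q w z *: x).
  by move=> a y z; rewrite !(polarE qP) scalerA -scalerDl; congr (_ *: _); ring.
pose al : {linear Q -> P} := HB.pack (fun z => - polar q w z *: x)
  (GRing.isLinear.Build _ _ _ _ (fun z => - polar q w z *: x) al_lin).
have al'_lin : linear (fun f : dualmod P => - dual_fun f x *: w).
  move=> a f g.
  by rewrite dual_addE dual_scaleE scalerA -scalerDl; congr (_ *: _); ring.
pose al' : {linear dualmod P -> Q} := HB.pack (fun f : dualmod P => - dual_fun f x *: w)
  (GRing.isLinear.Build _ _ _ _ (fun f : dualmod P => - dual_fun f x *: w) al'_lin).
left; exists al, al'; split=> [z|f z|].
- by apply: ideal_mulZ; apply: JN.
- by rewrite /= (polarZl qP) dual_funZ; ring.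
apply/funext => -[[z y] f]; rewrite /transv polar_inP polar_inQ quad_inQ /=.
apply: hypE; rewrite /= ?scaler0 ?addr0 ?add0r ?oppr0 ?addr0 //.
  by rewrite scaleNr opprK.
have qw : q w = inv2 A * polar q w w by apply: (quad_half qP).
by rewrite (polarZr qP) qw; lincomb.
Qed.

Lemma transv_elementary_F (J : set A) f w : (forall z, J (polar q w z)) ->
  (forall a, J a -> J (- a)) -> elementary q J (transv hq (inF f) (inQ w)).
Proof.
move=> Jw JN.
have be_lin : linear (fun z => - polar q w z *: f).
  by move=> a y z; rewrite !(polarE qP) scalerA -scalerDl; congr (_ *: _); ring.
pose be : {linear Q -> dualmod P} := HB.pack (fun z => - polar q w z *: f)
  (GRing.isLinear.Build _ _ _ _ (fun z => - polar q w z *: f) be_lin).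
have be'_lin : linear (fun x : P => - dual_fun f x *: w).
  by move=> a x y; rewrite dual_funD dual_funZ scalerA -scalerDl; congr (_ *: _); ring.
pose be' : {linear P -> Q} := HB.pack (fun x : P => - dual_fun f x *: w)
  (GRing.isLinear.Build _ _ _ _ (fun x : P => - dual_fun f x *: w) be'_lin).
right; exists be, be'; split=> [z|x z|].
- by apply: ideal_mulZ; apply: JN.
- by rewrite /= dual_scaleE (polarZl qP); ring.
apply/funext => -[[z y] g]; rewrite /transv polar_inF polar_inQ quad_inQ /=.
apply: hypE; rewrite /= ?scaler0 ?addr0 ?add0r ?oppr0 ?addr0 //.
  by rewrite scaleNr opprK.
have qw : q w = inv2 A * polar q w w by apply: (quad_half qP).
by rewrite (polarZr qP) qw; lincomb.
Qed.

End Elementary.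
End Hyp.

(** * Frames of polynomial extensions *)

Section PolyFrame.
Variables (k : comNzRingType) (Q P : lmodType k) (q : Q -> k).
Hypothesis qP : is_quadratic q.
Variables (r : nat) (a b : 'I_r -> Q) (s : nat) (p : 'I_s -> P) (f : 'I_s -> dualmod P).
Hypothesis ab : adjoint_basis q a b.
Hypothesis pf : dual_basis p f.
Local Notation qX := (ext_quad polyC q).
Local Notation hq := (@hyp_quad {poly k} (polyExt Q) (polyExt P) qX).

Let qXP : is_quadratic qX := ext_quad_quadratic polyC qP.

Definition hyp_fvec (i : 'I_r + ('I_s + 'I_s)) : hyp (polyExt Q) (polyExt P) :=
  match i with
  | inl i => inQ _ (tens polyC 1 (a i))
  | inr (inl j) => inP _ (tens polyC 1 (p j))
  | inr (inr j) => inF _ (ext_dual polyC (f j))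
  end.

Definition hyp_fcoord (i : 'I_r + ('I_s + 'I_s)) (u : hyp (polyExt Q) (polyExt P)) :
    {poly k} :=
  match i with
  | inl i => polar qX (tens polyC 1 (b i)) u.1.1
  | inr (inl j) => dual_fun (ext_dual polyC (f j)) u.1.2
  | inr (inr j) => dual_fun u.2 (tens polyC 1 (p j))
  end.

Lemma hyp_fcoord_scalar i : scalar (hyp_fcoord i).
Proof.
move=> c u v; case: i => [i|[j|j]] /=.
- by rewrite (polarDr qXP) (polarZr qXP).
- by rewrite dual_funD dual_funZ.
- by rewrite dual_addE dual_scaleE.
Qed.

Lemma hyp_frameE y : y = \sum_i hyp_fcoord i y *: hyp_fvec i.
Proof.
rewrite !big_sumType /=.
rewrite -(linear_combf _ (fun i => polar qX (tens polyC 1 (b i)) y.1.1)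
  (fun i => tens polyC 1 (a i)) (@inQ_linear _ (polyExt Q) (polyExt P))).
rewrite -(linear_combf _ (fun j => dual_fun (ext_dual polyC (f j)) y.1.2)
  (fun j => tens polyC 1 (p j)) (@inP_linear _ (polyExt Q) (polyExt P))).
rewrite -(linear_combf _ (fun j => dual_fun y.2 (tens polyC 1 (p j)))
  (fun j => ext_dual polyC (f j)) (@inF_linear _ (polyExt Q) (polyExt P))).
rewrite -(adjoint_basis_ext qP ab y.1.1) -(dual_basis_ext pf y.1.2).
rewrite -(dual_basis_dual _ (dual_basis_ext pf)).
by apply: hypE; rewrite /= ?add0r ?addr0.
Qed.

Lemma hyp_fcoord_const i j : exists c, hyp_fcoord i (hyp_fvec j) = c%:P.
Proof.
case: i j => [i|[i|i]] [j|[j|j]] /=;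
  rewrite ?polar0r // ?dual_fun0 ?(ext_polar_tens polyC qP) ?ext_dual_tens ?mul1r;
  by [exists 0 | eexists].
Qed.

Lemma hyp_fpolar_const i j : exists c, polar hq (hyp_fvec i) (hyp_fvec j) = c%:P.
Proof.
case: i j => [i|[i|i]] [j|[j|j]];
  rewrite /= ?polar_inQ ?(polar_inP qXP) ?(polar_inF qXP) /=
    ?(polar0r qXP) ?dual_fun0 ?(ext_polar_tens polyC qP) ?ext_dual_tens ?mul1r;
  by [exists 0 | eexists].
Qed.

Definition hyp_frame : frame hq :=
  Frame hyp_fcoord_scalar hyp_frameE hyp_fcoord_const hyp_fpolar_const.

End PolyFrame.

Section Ideals.
Variable A : comNzRingType.
Implicit Types (N : lmodType A) (I J : set A).

Lemma submod_spanD N (S : set N) x y :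
  submod_span S x -> submod_span S y -> submod_span S (x + y).
Proof.
move=> [l [lS ->]] [l' [lS' ->]]; exists (l ++ l'); rewrite big_cat; split=> // c.
by rewrite mem_cat => /orP[/lS|/lS'].
Qed.

Lemma submod_spanZ N (S : set N) a x : submod_span S x -> submod_span S (a *: x).
Proof.
move=> [l [lS ->]]; exists [seq (a * c.1, c.2) | c <- l]; split.
  by move=> _ /mapP[c cl ->] /=; apply: lS.
by rewrite big_map scaler_sumr; apply: eq_bigr => c _; rewrite scalerA.
Qed.

Lemma submod_span0 N (S : set N) : submod_span S 0.
Proof. by exists [::]; rewrite big_nil. Qed.

Lemma submod_span_mem N (S : set N) x : S x -> submod_span S x.
Proof.
move=> Sx; exists [:: (1, x)]; rewrite big_seq1 scale1r; split=> // c.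
by rewrite inE => /eqP ->.
Qed.

Lemma submod_span_min N (S T : set N) : T 0 -> (forall x y, T x -> T y -> T (x + y)) ->
  (forall a x, S x -> T (a *: x)) -> forall x, submod_span S x -> T x.
Proof.
move=> T0 TD TS _ [l [lS ->]]; elim: l lS => [|c l IH] lS; first by rewrite big_nil.
rewrite big_cons; apply: TD; first by apply: TS; apply: lS; rewrite inE eqxx.
by apply: IH => d dl; apply: lS; rewrite inE dl orbT.
Qed.

Lemma is_ideal_sum J (K : Type) (r : seq K) (F : K -> A) : is_ideal J ->
  (forall i, J (F i)) -> J (\sum_(i <- r) F i).
Proof. by case=> J0 JD _ JF; elim/big_ind: _. Qed.

Lemma is_idealN J x : is_ideal J -> J x -> J (- x).
Proof. by case=> _ _ JM Jx; rewrite -mulN1r; apply: JM. Qed.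

Lemma linear_ideal_mul N J (g : N -> A) : is_ideal J -> scalar g ->
  forall x, ideal_mul N J x -> J (g x).
Proof.
move=> [J0 JD JM] gl; have g0 : g 0 = 0 by apply: (linear0f (W := A^o)).
have gZ a x : g (a *: x) = a * g x by apply: (linearZf (W := A^o)).
have gD x y : g (x + y) = g x + g y by apply: (linearDf (W := A^o)).
apply: submod_span_min => [|x y|a _ [b [x [Jb ->]]]]; first by rewrite g0.
  by rewrite gD; apply: JD.
by rewrite !gZ; apply: (JM); rewrite mulrC; apply: JM.
Qed.

End Ideals.

Lemma extIdeal_ideal (A B : comNzRingType) (phi : A -> B) (I : set A) :
  is_ideal (extIdeal phi I).
Proof.
split=> [|x y|a x]; first exact: submod_span0.
  exact: submod_spanD.
exact: (submod_spanZ (N := B^o)).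
Qed.

Lemma extIdeal_mem (A B : comNzRingType) (phi : A -> B) (I : set A) x :
  I x -> extIdeal phi I (phi x).
Proof. by move=> Ix; apply: submod_span_mem; exists x. Qed.

Lemma extIdeal_min (A B : comNzRingType) (phi : A -> B) (I : set A) (T : set B) :
  T 0 -> (forall x y, T x -> T y -> T (x + y)) ->
  (forall a x, I x -> T (a * phi x)) -> forall x, extIdeal phi I x -> T x.
Proof.
move=> T0 TD TS; apply: (submod_span_min (N := B^o)) => // a _ [x Ix ->].
exact: TS.
Qed.

Section RescaleIdeal.
Variables (k : comNzRingType) (I : set k).
Local Notation IX := (extIdeal polyC I).

Lemma rescale_ideal b p : IX p -> IX (rescale b p).
Proof.
have [I0 ID IM] := @extIdeal_ideal _ _ polyC I.
move: p; apply: extIdeal_min; first by rewrite rescale0.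
  by move=> p r Ip Ir; rewrite rescaleD; apply: ID.
by move=> p x Ix; rewrite rescaleM rescaleC; apply: IM; apply: extIdeal_mem.
Qed.

Lemma rescale_shift_ideal b t c p : IX p ->
  exists2 r, IX r & rescale (b + t * c) p = rescale b p + t%:P * r.
Proof.
have [I0 ID IM] := @extIdeal_ideal _ _ polyC I.
move: p; apply: extIdeal_min.
- by exists 0; rewrite // !rescale0 mulr0 addr0.
- move=> p p' [r Ir e] [r' Ir' e']; exists (r + r'); first exact: ID.
  by rewrite !rescaleD e e' mulrDr addrACA.
- move=> p x Ix; have [r e] := rescale_shift b t c p.
  exists (r * x%:P); first by apply: IM; apply: extIdeal_mem.
  by rewrite !rescaleM !rescaleC e; ring.
Qed.

End RescaleIdeal.

(** * Denominators and base change *)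

Section Denominators.
Variables (R : comNzRingType) (p : primeIdeal R).
Local Notation K := (localized p).
Local Notation polyLoc := (polyLoc p).

Lemma prime_compl1 : ~ p 1. Proof. by case: (prime_setP p). Qed.

Lemma prime_complM s t : ~ p s -> ~ p t -> ~ p (s * t).
Proof. by move=> ns nt; case: (prime_setP p) => _ _ pM /pM[]. Qed.

Lemma prime_common (T : finType) (Pr : T -> R -> Prop) :
  (forall x s t, Pr x s -> Pr x (t * s)) -> (forall x, exists2 t, ~ p t & Pr x t) ->
  exists2 t, ~ p t & forall x, Pr x t.
Proof.
move=> PM Px; suff [t nt tP] : exists2 t, ~ p t & forall x, x \in enum T -> Pr x t.
  by exists t => // x; apply: tP; rewrite mem_enum.
elim: (enum T) => [|x l [t nt tP]]; first by exists 1; first exact: prime_compl1.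
have [s ns sP] := Px x; exists (t * s); first exact: prime_complM.
move=> y; rewrite inE => /orP[/eqP ->|yl]; first exact: PM.
by rewrite mulrC; apply: PM; apply: tP.
Qed.

Lemma toloc_unit s : ~ p s -> exists t, t * toloc p s = 1.
Proof.
move=> ns; have ds : `[< ~ p s >] by apply/asboolP.
exists (\pi_(localized p) (1, exist _ s ds)).
rewrite -[LHS]/(loc_mul _ _) loc_mulE; apply/loc_eqP; exists (denom1 p).
by rewrite /= /dval /=; ring.
Qed.

Lemma toloc_eq0 x : toloc p x = 0 -> exists2 s, ~ p s & s * x = 0.
Proof.
move=> /loc_eqP[u] /= e; exists (dval u); first exact: denomP.
by move: e; rewrite !mul0r mulr0 !mulr1.
Qed.

Lemma loc_denominator (c : K) : exists2 t, ~ p t & exists x, toloc p t * c = toloc p x.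
Proof.
elim/quotW: c => -[x s]; exists (dval s); first exact: denomP.
exists x; rewrite -[LHS]/(loc_mul _ _) loc_mulE; apply/loc_eqP; exists (denom1 p).
by rewrite /= /dval /=; ring.
Qed.

Lemma polyLocC x : polyLoc x%:P = (toloc p x)%:P.
Proof. exact: map_polyC. Qed.

Lemma polyLocZD a b c : polyLoc (a * b + c) = polyLoc a * polyLoc b + polyLoc c.
Proof. by rewrite rmorphD rmorphM. Qed.

Lemma polyLoc_rescale b c : polyLoc (rescale b c) = rescale (toloc p b) (polyLoc c).
Proof.
rewrite /rescale /polyLoc map_comp_poly rmorphM /= map_polyC map_polyX //.
Qed.

Lemma poly_denominator (c : {poly K}) :
  exists2 t, ~ p t & exists x, (toloc p t)%:P * c = polyLoc x.
Proof.
elim/poly_ind: c => [|c a [t nt [x e]]].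
  by exists 1; [exact: prime_compl1 | exists 0; rewrite mulr0 rmorph0].
have [s ns [y e']] := loc_denominator a.
exists (t * s); first exact: prime_complM.
exists (s%:P * x * 'X + (t * y)%:P).
rewrite rmorphM polyCM rmorphD !rmorphM /= !polyLocC -e.
have -> : polyLoc 'X = 'X by apply: map_polyX.
rewrite -e' !polyCM.
by move: (toloc p t)%:P (toloc p s)%:P => a1 a2; ring.
Qed.

(** An element of the localized ideal is a sum of multiples of elements of I by
    arbitrary polynomials over K, whose denominators are cleared in turn. *)
Section IdealDenominator.
Variable I : set R.
Local Notation IX := (extIdeal polyC I).

Definition ideal_fraction (c : {poly K}) : Prop :=
  exists2 t, ~ p t & exists2 x, IX x & (toloc p t)%:P * c = polyLoc x.

Lemma ideal_fraction0 : ideal_fraction 0.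
Proof.
exists 1; first exact: prime_compl1.
by exists 0; [case: (@extIdeal_ideal _ _ polyC I) | rewrite mulr0 rmorph0].
Qed.

Lemma ideal_fractionD x y :
  ideal_fraction x -> ideal_fraction y -> ideal_fraction (x + y).
Proof.
have [_ ID IM] := @extIdeal_ideal _ _ polyC I.
move=> [t nt [x' Ix' e]] [s ns [y' Iy' e']].
exists (t * s); first exact: prime_complM.
exists (s%:P * x' + t%:P * y'); first by apply: ID; apply: IM.
rewrite rmorphD !rmorphM /= !polyLocC -e -e'.
by move: (toloc p t)%:P (toloc p s)%:P => a b; ring.
Qed.

Lemma poly_ideal_denominator c :
  extIdeal polyC (extIdeal (toloc p) I) c -> ideal_fraction c.
Proof.
have [_ _ IM] := @extIdeal_ideal _ _ polyC I.
move: c; apply: (extIdeal_min ideal_fraction0 ideal_fractionD) => c x Ix.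
apply: (@extIdeal_min _ _ (toloc p) I (fun x => forall c, ideal_fraction (c * x%:P)))
  Ix c => [c|{}x y Dx Dy c|a {}x Ix c].
- by rewrite mulr0; apply: ideal_fraction0.
- by rewrite polyCD mulrDr; apply: ideal_fractionD.
- have [t nt [y e]] := poly_denominator (c * a%:P).
  exists t => //; exists (y * x%:P); first by apply: IM; apply: extIdeal_mem.
  have -> : polyLoc (y * x%:P) = polyLoc y * polyLoc x%:P by apply: rmorphM.
  rewrite -e polyLocC polyCM; move: (toloc p t)%:P (toloc p x)%:P (a%:P) => a1 a2 a3.
  by rewrite !mulrA.
Qed.

End IdealDenominator.

End Denominators.

Section BaseChange.
Variables (R : comNzRingType) (p : primeIdeal R) (Q P : lmodType R) (q : Q -> R).
Hypothesis qP : is_quadratic q.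
Local Notation K := (localized p).
Local Notation polyLoc := (polyLoc p).
Local Notation qX := (ext_quad polyC q).
Local Notation qK := (ext_quad (toloc p) q).
Local Notation qKX := (ext_quad polyC qK).
Local Notation HX := (hyp (polyExt Q) (polyExt P)).
Local Notation HKX := (hyp (polyExt (locExt p Q)) (polyExt (locExt p P))).
Local Notation hqX := (@hyp_quad {poly R} (polyExt Q) (polyExt P) qX).
Local Notation hqKX :=
  (@hyp_quad {poly K} (polyExt (locExt p Q)) (polyExt (locExt p P)) qKX).
Local Notation lam := (@hyp_locX R p Q P).

Let qXP : is_quadratic qX := ext_quad_quadratic polyC qP.
Let qKP : is_quadratic qK := ext_quad_quadratic (toloc p) qP.
Let qKXP : is_quadratic qKX := ext_quad_quadratic polyC qKP.

Section LocX.
Variable N : lmodType R.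

Lemma locXZD a (x y : polyExt N) : locX p (a *: x + y) = polyLoc a *: locX p x + locX p y.
Proof. exact: locX_semilin. Qed.
Lemma locXD (x y : polyExt N) : locX p (x + y) = locX p x + locX p y.
Proof. by have := locXZD 1 x y; rewrite rmorph1 !scale1r. Qed.
Lemma locX0 : locX p (0 : polyExt N) = 0.
Proof. by apply: (addrI (locX p 0)); rewrite -locXD !addr0. Qed.
Lemma locXZ a (x : polyExt N) : locX p (a *: x) = polyLoc a *: locX p x.
Proof. by have := locXZD a x 0; rewrite locX0 !addr0. Qed.
Lemma locX_sum I (r : seq I) (F : I -> polyExt N) :
  locX p (\sum_(i <- r) F i) = \sum_(i <- r) locX p (F i).
Proof. exact: (big_morph (locX p (N := N)) locXD locX0). Qed.

Lemma locX_tens1 (x : N) : locX p (tens polyC 1 x) = tens polyC 1 (tens (toloc p) 1 x).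
Proof.
transitivity (polyLoc 1 *: tens polyC 1 (tens (toloc p) 1 x)).
  exact: (ext_lift_tens (locX_tens_semilin p (N := N))).
have -> : polyLoc 1 = 1 by apply: rmorph1.
exact: scale1r.
Qed.

(** A linear condition holds everywhere as soon as it holds on the image of
    N. *)
Lemma locX_ind (T : polyExt (locExt p N) -> Prop) :
  (forall b x y, T x -> T y -> T (b *: x + y)) -> T 0 ->
  (forall x, T (locX p (tens polyC 1 x))) -> forall x, T x.
Proof.
move=> TD T0 Tx; apply: ext_ind => //; apply: ext_ind => [b x y Tx' Ty||x].
- by rewrite tens1D tens1Z; apply: TD.
- by rewrite tens1_0.
- by rewrite -locX_tens1.
Qed.

Lemma dual_locX_ext (f g : dualmod (polyExt (locExt p N))) :
  (forall x, dual_fun f (locX p (tens polyC 1 x)) = dual_fun g (locX p (tens polyC 1 x))) ->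
  f = g.
Proof.
move=> fg; apply: dualP; apply: locX_ind => [b x y ex ey||x] //.
- by rewrite !dual_funD !dual_funZ ex ey.
- by rewrite !dual_fun0.
Qed.

Lemma dual_locXZD a (f g : dualmod (polyExt N)) :
  dual_locX p (a *: f + g) = polyLoc a *: dual_locX p f + dual_locX p g.
Proof.
apply: dual_locX_ext => x.
by rewrite dual_addE dual_scaleE !dual_locXP dual_addE dual_scaleE polyLocZD.
Qed.

Lemma dual_locX_ext_dual (f : dualmod N) :
  dual_locX p (ext_dual polyC f) = ext_dual polyC (ext_dual (toloc p) f).
Proof.
apply: dual_locX_ext => x; rewrite dual_locXP locX_tens1 !ext_dual_tens !mul1r.
by rewrite polyLocC.
Qed.

End LocX.

Lemma polar_locX x y : polar qKX (locX p x) (locX p y) = polyLoc (polar qX x y).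
Proof.
move: x; apply: ext_ind => [b x x' ex ex'||x].
- by rewrite locXZD !(polarE qKXP) !(polarE qXP) ex ex' polyLocZD.
- by rewrite locX0 (polar0l qKXP) (polar0l qXP) rmorph0.
move: y; apply: ext_ind => [b y y' ey ey'||y].
- by rewrite locXZD !(polarE qKXP) !(polarE qXP) ey ey' polyLocZD.
- by rewrite locX0 (polar0r qKXP) (polar0r qXP) rmorph0.
rewrite !locX_tens1 (ext_polar_tens _ qKP) (ext_polar_tens _ qP) (ext_polar_tens _ qP).
by rewrite !mul1r polyLocC.
Qed.

Lemma lamZD a u v : lam (a *: u + v) = polyLoc a *: lam u + lam v.
Proof. by apply: hypE; rewrite /= ?locXZD ?dual_locXZD. Qed.
Lemma lamD u v : lam (u + v) = lam u + lam v.
Proof. by have := lamZD 1 u v; rewrite rmorph1 !scale1r. Qed.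
Lemma lam0 : lam 0 = 0.
Proof. by apply: (addrI (lam 0)); rewrite -lamD !addr0. Qed.
Lemma lamZ a u : lam (a *: u) = polyLoc a *: lam u.
Proof. by have := lamZD a u 0; rewrite lam0 !addr0. Qed.
Lemma lamN u : lam (- u) = - lam u.
Proof. by apply: (addrI (lam u)); rewrite -lamD !subrr lam0. Qed.
Lemma lam_sum I (r : seq I) (F : I -> HX) :
  lam (\sum_(i <- r) F i) = \sum_(i <- r) lam (F i).
Proof. exact: (big_morph lam lamD lam0). Qed.

Lemma lam_inQ z : lam (inQ _ z) = inQ _ (locX p z).
Proof.
apply: hypE; rewrite /= ?locX0 //.
by apply: dual_locX_ext => x; rewrite dual_locXP rmorph0.
Qed.
Lemma lam_inP x : lam (inP _ x) = inP _ (locX p x).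
Proof.
apply: hypE; rewrite /= ?locX0 //.
by apply: dual_locX_ext => y; rewrite dual_locXP rmorph0.
Qed.
Lemma lam_inF f : lam (inF _ f) = inF _ (dual_locX p f).
Proof. by apply: hypE; rewrite /= ?locX0. Qed.

Lemma polar_lam u v : polar hqKX (lam u) (lam v) = polyLoc (polar hqX u v).
Proof. by rewrite !polar_hypE /= polar_locX !dual_locXP -!rmorphD. Qed.

End BaseChange.

(** * The lattice over a localization *)

Section LocalLattice.
Variables (R : comNzRingType) (p : primeIdeal R) (Q P : lmodType R) (q : Q -> R).
Hypothesis qP : is_quadratic q.
Variables (half : R) (I : set R).
Hypothesis half2 : 2%:R * half = 1.
Variables (r : nat) (a b : 'I_r -> Q) (s : nat) (x : 'I_s -> P) (f : 'I_s -> dualmod P).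
Hypothesis ab : adjoint_basis q a b.
Hypothesis xf : dual_basis x f.
Local Notation K := (localized p).
Local Notation polyLoc := (polyLoc p).
Local Notation qX := (ext_quad polyC q).
Local Notation qK := (ext_quad (toloc p) q).
Local Notation qKX := (ext_quad polyC qK).
Local Notation HX := (hyp (polyExt Q) (polyExt P)).
Local Notation HKX := (hyp (polyExt (locExt p Q)) (polyExt (locExt p P))).
Local Notation hqX := (@hyp_quad {poly R} (polyExt Q) (polyExt P) qX).
Local Notation hqKX :=
  (@hyp_quad {poly K} (polyExt (locExt p Q)) (polyExt (locExt p P)) qKX).
Local Notation lam := (@hyp_locX R p Q P).
Local Notation IX := (extIdeal polyC I).
Local Notation toK t := ((toloc p t)%:P : {poly K}).

Let qXP : is_quadratic qX := ext_quad_quadratic polyC qP.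
Let qKP : is_quadratic qK := ext_quad_quadratic (toloc p) qP.
Let qKXP : is_quadratic qKX := ext_quad_quadratic polyC qKP.
Let abX := adjoint_basis_ext (phi := polyC) qP ab.
Let abK := adjoint_basis_ext (phi := toloc p) qP ab.
Let abKX := adjoint_basis_ext (phi := polyC) qKP abK.
Let xfK := dual_basis_ext (phi := toloc p) xf.

Definition FX : frame hqX := hyp_frame qP ab xf.
Definition FK : frame hqKX := hyp_frame qKP abK xfK.

Lemma lam_fvec i : lam (fvec (f := FX) i) = fvec (f := FK) i.
Proof.
case: i => [i|[i|i]] /=.
- by rewrite lam_inQ locX_tens1.
- by rewrite lam_inP locX_tens1.
- by rewrite lam_inF dual_locX_ext_dual.
Qed.

Lemma lam_fcoord i u : fcoord (f := FK) i (lam u) = polyLoc (fcoord (f := FX) i u).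
Proof.
case: i => [i|[i|i]] /=.
- by rewrite -locX_tens1 (polar_locX _ qP).
- by rewrite -dual_locX_ext_dual dual_locXP.
- by rewrite -locX_tens1 dual_locXP.
Qed.

Lemma lam_frescale t u :
  lam (frescale FX t u) = frescale FK (toloc p t) (lam u).
Proof.
rewrite /frescale lam_sum; apply: eq_bigr => i _.
by rewrite lamZ lam_fvec polyLoc_rescale lam_fcoord.
Qed.

Lemma lam_twist t g gK u : linear g -> linear gK ->
  (forall v, gK (lam v) = lam (g v)) ->
  twist FK (toloc p t) gK (lam u) = lam (twist FX t g u).
Proof.
move=> gl gKl gE; rewrite /twist lam_sum; apply: eq_bigr => i _.
by rewrite lamZ -lam_fvec gE lam_frescale lam_fcoord.
Qed.

Lemma toKM t c : toK (t * c) = toK t * toK c.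
Proof. by rewrite -polyCM; congr polyC; apply: rmorphM. Qed.

Lemma toK1 : toK 1 = 1.
Proof. by rewrite -polyC1; congr polyC; apply: rmorph1. Qed.

Lemma denominator_mul t c (z : {poly K}) v : toK t * z = polyLoc v ->
  toK (c * t) * z = polyLoc (c%:P * v).
Proof.
move=> e; have -> : polyLoc (c%:P * v) = polyLoc c%:P * polyLoc v by apply: rmorphM.
by rewrite -e polyLocC toKM -mulrA.
Qed.

(** The coordinates on the frame are finite in number, so their denominators
    have a common multiple outside of p. *)
Lemma hyp_denominator (u : HKX) :
  exists2 t, ~ p t & exists v, toK t *: u = lam v.
Proof.
have [i t c [v e]|i|t nt H] := @prime_common _ p (frame_index FK)
  (fun i t => exists v, toK t * fcoord (f := FK) i u = polyLoc v).
- by exists (c%:P * v); apply: denominator_mul.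
- exact: poly_denominator.
have [v vE] := choice H.
exists t => //; exists (\sum_i v i *: fvec (f := FX) i).
rewrite [u](frameE FK) scaler_sumr lam_sum; apply: eq_bigr => i _.
by rewrite scalerA vE lamZ lam_fvec.
Qed.

(** Membership in I[X] Q[X], read on the coordinates. *)
Definition in_ideal (z : polyExt Q) : Prop :=
  forall k, IX (polar qX (tens polyC 1 (b k)) z).

Let IXI : is_ideal IX := @extIdeal_ideal _ _ polyC I.
Let IX0 : IX 0. Proof. by case: IXI. Qed.
Let IXD c d : IX c -> IX d -> IX (c + d). Proof. by case: IXI => _ H _; apply: H. Qed.
Let IXM c d : IX d -> IX (c * d). Proof. by case: IXI => _ _ H; apply: H. Qed.
Let IXMr c d : IX c -> IX (c * d). Proof. by rewrite mulrC; apply: IXM. Qed.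

Lemma in_ideal0 : in_ideal 0.
Proof. by move=> k; rewrite (polar0r qXP). Qed.
Lemma in_idealD z z' : in_ideal z -> in_ideal z' -> in_ideal (z + z').
Proof. by move=> Iz Iz' k; rewrite (polarDr qXP); apply: IXD. Qed.
Lemma in_idealZ c z : in_ideal z -> in_ideal (c *: z).
Proof. by move=> Iz k; rewrite (polarZr qXP); apply: IXM. Qed.
Lemma in_ideal_scale c z : IX c -> in_ideal (c *: z).
Proof. by move=> Ic k; rewrite (polarZr qXP); apply: IXMr. Qed.
Lemma in_ideal_comb (c : 'I_r -> {poly R}) (z : 'I_r -> polyExt Q) :
  (forall k, IX (c k)) -> in_ideal (\sum_k c k *: z k).
Proof.
move=> Ic; elim/big_ind: _; [exact: in_ideal0 | exact: in_idealD |].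
by move=> k _; apply: in_ideal_scale.
Qed.
Lemma in_ideal_polar z z' : in_ideal z -> IX (polar qX z z').
Proof.
move=> Iz; rewrite {1}[z](abX z) (polar_suml qXP).
by apply: is_ideal_sum => // k /=; rewrite (polarZl qXP); apply: IXMr.
Qed.
Lemma in_ideal_polarC z z' : in_ideal z -> IX (polar qX z' z).
Proof. by rewrite polarC; apply: in_ideal_polar. Qed.

Definition denK (c : {poly K}) : Prop := exists2 t, ~ p t & c = toK t.

Definition scalK (c : bool -> {poly K}) : Prop :=
  exists2 d, (forall n, c n = polyLoc (d n)) & IX (d true - d false).

Definition latK (z : bool -> HKX) : Prop :=
  exists2 y, (forall n, z n = inQ _ (locX p (y n))) & in_ideal (y true - y false).

Lemma denK1 : denK 1. Proof. by exists 1; rewrite ?toK1 //; exact: prime_compl1. Qed.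
Lemma denKM c d : denK c -> denK d -> denK (c * d).
Proof.
move=> [t nt ->] [t' nt' ->]; exists (t * t'); first exact: prime_complM.
by rewrite toKM.
Qed.
Lemma denK_unit c : denK c -> exists d, d * c = 1.
Proof.
move=> [t nt ->]; have [d e] := toloc_unit nt.
by exists d%:P; rewrite -polyCM e polyC1.
Qed.
Lemma scalK_poly c : scalK (fun=> polyLoc c).
Proof. by exists (fun=> c); rewrite ?subrr. Qed.
Lemma scalK_den c : denK c -> scalK (fun=> c).
Proof. by move=> [t nt ->]; rewrite -polyLocC; apply: scalK_poly. Qed.
Lemma scalK0 : scalK (fun=> 0).
Proof. by exists (fun=> 0); rewrite ?subrr // => n; rewrite rmorph0. Qed.
Lemma scalKN c : scalK c -> scalK (fun n => - c n).
Proof.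
move=> [d dE Id]; exists (fun n => - d n).
  by move=> n; rewrite dE -[RHS]/(polyLoc (- d n)); apply/esym/rmorphN.
by rewrite -opprD; apply: is_idealN.
Qed.
Lemma scalKM c c' : scalK c -> scalK c' -> scalK (fun n => c n * c' n).
Proof.
move=> [d dE Id] [d' dE' Id']; exists (fun n => d n * d' n).
  by move=> n; rewrite dE dE'; apply/esym/rmorphM.
have -> : d true * d' true - d false * d' false =
  d true * (d' true - d' false) + d' false * (d true - d false) by ring.
by apply: IXD; apply: IXM.
Qed.
Lemma latKD z z' : latK z -> latK z' -> latK (fun n => z n + z' n).
Proof.
move=> [y yE Iy] [y' yE' Iy']; exists (fun n => y n + y' n).
  by move=> n; rewrite yE yE' locXD inQD.
by rewrite opprD addrACA; apply: in_idealD.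
Qed.
Lemma latKZ c z : scalK c -> latK z -> latK (fun n => c n *: z n).
Proof.
move=> [d dE Id] [y yE Iy]; exists (fun n => d n *: y n).
  by move=> n; rewrite dE yE locXZ inQZ.
have -> : d true *: y true - d false *: y false =
  d true *: (y true - y false) + (d true - d false) *: y false by lincomb.
by apply: in_idealD; [apply: in_idealZ | apply: in_ideal_scale].
Qed.
Lemma latK_polar z z' : latK z -> latK z' -> scalK (fun n => polar hqKX (z n) (z' n)).
Proof.
move=> [y yE Iy] [y' yE' Iy']; exists (fun n => polar qX (y n) (y' n)).
  by move=> n; rewrite yE yE' polar_inQ /= (polar_locX _ qP).
have -> : polar qX (y true) (y' true) - polar qX (y false) (y' false) =
  polar qX (y true - y false) (y' true) + polar qX (y false) (y' true - y' false).
  by rewrite !(polarE qXP); ring.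
by apply: IXD; [apply: in_ideal_polar | apply: in_ideal_polarC].
Qed.

Lemma halfX2 : 2%:R * half%:P = 1 :> {poly R}.
Proof. by rewrite -polyC_natr -polyCM half2. Qed.
Lemma halfKX2 : 2%:R * toK half = 1.
Proof.
rewrite -polyLocC; have <- : polyLoc 2%:R = 2%:R by apply: rmorph_nat.
transitivity (polyLoc (2%:R * half%:P)); first by apply/esym/rmorphM.
by rewrite halfX2; apply: rmorph1.
Qed.
Let hqKXP : is_quadratic hqKX := hyp_quadratic _ qKXP.

Lemma latK_quad z : latK z -> scalK (fun n => hqKX (z n)).
Proof.
move=> Lz; have := scalKM (scalK_poly half%:P) (latK_polar Lz Lz); congr scalK.
by apply/funext => n; rewrite polyLocC [RHS](quad_half hqKXP halfKX2).
Qed.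

(** Clearing the denominators of the coordinates keeps them in the ideal. *)
Lemma in_ideal_denominator (z : polyExt (locExt p Q)) :
    (forall k, extIdeal polyC (extIdeal (toloc p) I)
       (polar qKX (tens polyC 1 (tens (toloc p) 1 (b k))) z)) ->
  exists2 t, ~ p t & exists2 y, in_ideal y & toK t *: z = locX p y.
Proof.
move=> Jz.
have [i t c [v Iv e]|i|t nt H] := @prime_common _ p _
  (fun (k : 'I_r) t => exists2 v, IX v &
     toK t * polar qKX (tens polyC 1 (tens (toloc p) 1 (b k))) z = polyLoc v).
- by exists (c%:P * v); [apply: IXM | apply: denominator_mul].
- exact: poly_ideal_denominator.
have {}H k : exists v, IX v /\
    toK t * polar qKX (tens polyC 1 (tens (toloc p) 1 (b k))) z = polyLoc v.
  by have [v] := H k; exists v.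
have [v vE] := choice H.
exists t => //; exists (\sum_k v k *: tens polyC 1 (a k)).
  by apply: in_ideal_comb => k; case: (vE k).
rewrite {1}[z](abKX z) scaler_sumr locX_sum; apply: eq_bigr => k _.
by rewrite scalerA; have [_ ->] := vE k; rewrite locXZ locX_tens1.
Qed.

(** The substitution of t X for X on Q[X]. *)
Definition rescaleQ t (y : polyExt Q) : polyExt Q :=
  \sum_k rescale t (polar qX (tens polyC 1 (b k)) y) *: tens polyC 1 (a k).

Lemma frescale_inQ t y : frescale FX t (inQ _ y) = inQ _ (rescaleQ t y).
Proof.
rewrite /frescale !big_sumType /= -(linear_combf _ _ _ (@inQ_linear _ _ _)).
rewrite [X in _ + (X + _)]big1 => [|i _]; last by rewrite dual_fun0 rescale0 scale0r.
rewrite [X in _ + (_ + X)]big1 => [|i _]; last by rewrite rescale0 scale0r.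
by rewrite !addr0.
Qed.

Lemma rescaleQB t y y' : rescaleQ t y - rescaleQ t y' =
  \sum_k rescale t (polar qX (tens polyC 1 (b k)) (y - y')) *: tens polyC 1 (a k).
Proof.
rewrite /rescaleQ -sumrB; apply: eq_bigr => k _.
by rewrite (polarDr qXP) (polarNr qXP) -scalerBl -rescaleB.
Qed.

Definition from_base (t : K) : Prop := exists c, t = toloc p c.

Lemma latK_frescale (t : K) z : from_base t -> latK z ->
  latK (fun n => frescale FK t (z n)).
Proof.
move=> [c ->] [y yE Iy]; exists (fun n => rescaleQ c (y n)).
  by move=> n; rewrite yE -lam_inQ -lam_frescale frescale_inQ lam_inQ.
by rewrite rescaleQB; apply: in_ideal_comb => k; apply: rescale_ideal.
Qed.

Lemma latK_shift (t0 t c : K) z : from_base t0 -> from_base t -> from_base c -> latK z ->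
  exists2 z', latK z' & forall n,
    frescale FK (t0 + t * c) (z n) = frescale FK t0 (z n) + t%:P *: z' n.
Proof.
move=> [t0' ->] [t' ->] [c' ->] [y yE Iy].
pose cf k n := polar qX (tens polyC 1 (b k)) (y n).
have [d dE] := choice (fun k => rescale_shift t0' t' c' (cf k false)).
have H k : exists d', IX d' /\
    rescale (t0' + t' * c') (cf k true) = rescale t0' (cf k true) + t'%:P * (d k + d').
  have [dl Idl ->] : exists2 dl, IX dl & cf k true = cf k false + dl.
    exists (polar qX (tens polyC 1 (b k)) (y true - y false)); first exact: Iy.
    by rewrite -(polarDr qXP) addrC subrK.
  have [d' Id' d'E] := rescale_shift_ideal t0' t' c' Idl; exists d'; split=> //.
  by rewrite 2!(rescaleD _ (cf k false) dl) dE d'E; ring.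
have [d' d'E] := choice H.
pose y' n := \sum_k (d k + (if n then d' k else 0)) *: tens polyC 1 (a k).
exists (fun n => inQ _ (locX p (y' n))).
  exists y' => //; rewrite /y' -sumrB.
  under eq_bigr => k _ do rewrite -scalerBl addr0 addrAC subrr add0r.
  by apply: in_ideal_comb => k; case: (d'E k).
move=> n; rewrite yE -lam_inQ.
have -> : toloc p t0' + toloc p t' * toloc p c' = toloc p (t0' + t' * c').
  by rewrite rmorphD rmorphM.
rewrite -!lam_frescale !frescale_inQ -polyLocC -lam_inQ -lamZ -lamD; congr lam.
rewrite -inQZ -inQD.
congr inQ; rewrite /rescaleQ /y' scaler_sumr -big_split; apply: eq_bigr => k _ /=.
rewrite scalerA -scalerDl; congr (_ *: _); case: n.
  by case: (d'E k).
by rewrite addr0; apply: dE.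
Qed.

(** The coordinates of u lie in the kernel of R[X] -> K[X]. *)
Lemma lam_eq0 s' u : (forall c, toloc p c = 0 -> s' * c = 0) ->
  lam u = 0 -> s'%:P *: u = 0.
Proof.
move=> s'0 u0; rewrite [u](frameE FX) scaler_sumr big1 // => i _; rewrite scalerA.
suff -> : s'%:P * fcoord (f := FX) i u = 0 by rewrite scale0r.
apply/polyP => n; rewrite coefCM coef0; apply: s'0.
have : polyLoc (fcoord (f := FX) i u) = 0 by rewrite -lam_fcoord u0 fcoord0.
by move/polyP/(_ n); rewrite coef_map coef0.
Qed.

(** The difference s' z of the two vectors maps to 0, hence so does z, as s'
    becomes invertible; but s' kills the kernel. *)
Lemma lam_inj s' u u' z : ~ p s' -> (forall c, toloc p c = 0 -> s' * c = 0) ->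
  u = u' + s'%:P *: z -> lam u = lam u' -> u = u'.
Proof.
move=> ns' s'0 uE le; rewrite uE; suff -> : s'%:P *: z = 0 by rewrite addr0.
apply: lam_eq0 => //; have [c cs] := toloc_unit ns'.
have : toK s' *: lam z = 0.
  by rewrite -polyLocC -lamZ; move: le; rewrite uE lamD => /(canRL (addKr _)) ->; rewrite addNr.
move/(congr1 (fun v0 : HKX => c%:P *: v0)); rewrite scaler0 scalerA -polyCM cs.
by rewrite scale1r.
Qed.

Section Axes.
Variables (m : nat) (e : 'I_m -> locExt p P) (g : 'I_m -> dualmod (locExt p P)).
Hypothesis m_gt1 : (1 < m)%N.
Hypothesis ge : forall i j, dual_fun (g i) (e j) = (i == j)%:R.
Variables v w : locExt p Q.
Hypothesis vw : polar qK v w = 1.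

Definition local_axis (c : 'I_m * bool) : HKX :=
  if c.2 then inP _ (tens polyC 1 (e c.1)) else inF _ (ext_dual polyC (g c.1)).

Lemma local_axis_quad c : hqKX (local_axis c) = 0.
Proof. by rewrite /local_axis; case: ifP => _; rewrite (quad_inP, quad_inF). Qed.

Lemma local_axis_polar c d :
  polar hqKX (local_axis c) (local_axis d) = (d == (c.1, ~~ c.2))%:R.
Proof.
case: c d => [i [|]] [j [|]]; rewrite /local_axis /= xpair_eqE /=
  ?(polar_inP qKXP) ?(polar_inF qKXP) /= ?andbF ?andbT ?dual_fun0 // ext_dual_tens mul1r ge.
  exact: rmorph_nat.
by rewrite eq_sym; apply: rmorph_nat.
Qed.

Lemma local_axis_orth z c k : latK z -> polar hqKX (local_axis c) (z k) = 0.
Proof.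
move=> [y yE _]; rewrite yE polarC polar_inQ /local_axis.
by case: ifP => _ /=; rewrite (polar0r qKXP).
Qed.

Lemma latK_const z : exists2 t, ~ p t & latK (fun=> toK t *: inQ _ z).
Proof.
have [t nt [y e1]] := hyp_denominator (inQ _ z).
exists t => //; exists (fun=> y.1.1); last by rewrite subrr; apply: in_ideal0.
move=> _; move/(congr1 (fun u : HKX => u.1.1)): e1 => /= e1.
by rewrite -inQZ e1.
Qed.

Lemma polar_vw : polar hqKX (inQ _ (tens polyC 1 v)) (inQ _ (tens polyC 1 w)) = 1.
Proof. by rewrite polar_inQ /= (ext_polar_tens _ qKP) vw !mul1r. Qed.

Lemma common_vw : exists2 t, denK t &
  latK (fun=> t *: inQ _ (tens polyC 1 v)) /\ latK (fun=> t *: inQ _ (tens polyC 1 w)).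
Proof.
have [t nt Lt] := latK_const (tens polyC 1 v).
have [t' nt' Lt'] := latK_const (tens polyC 1 w).
have D1 : denK (toK t) by exists t.
have D2 : denK (toK t') by exists t'.
exists (toK t * toK t'); first exact: denKM.
split.
  rewrite mulrC; have := latKZ (scalK_den D2) Lt; congr latK.
  by apply/funext => n; rewrite scalerA.
have := latKZ (scalK_den D1) Lt'; congr latK.
by apply/funext => n; rewrite scalerA.
Qed.

Lemma local_axisC (t : K) d : frescale FK t (local_axis d) = local_axis d.
Proof.
rewrite [RHS](frameE FK) /frescale; apply: eq_bigr => i _; congr (_ *: _).
suff [c ->] : exists c, fcoord (f := FK) i (local_axis d) = c%:P by rewrite rescaleC.
rewrite /local_axis; case: ifP => _; case: i => [i|[i|i]] /=.
- by exists 0; rewrite (polar0r qKXP).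
- by eexists; rewrite ext_dual_tens mul1r.
- by exists 0.
- by exists 0; rewrite (polar0r qKXP).
- by exists 0; rewrite dual_fun0.
- by eexists; rewrite ext_dual_tens mul1r.
Qed.

Section Lattice.
Variable t : {poly K}.
Hypothesis Dt : denK t.
Hypothesis Lv : latK (fun=> t *: inQ _ (tens polyC 1 v)).
Hypothesis Lw : latK (fun=> t *: inQ _ (tens polyC 1 w)).

Definition local_lattice : lattice hqKX :=
  @Lattice _ _ hqKX m local_axis denK scalK latK _ _ t m_gt1 local_axis_quad
    local_axis_polar denK1 denKM denK_unit scalK_den scalK0 scalKN scalKM latKD latKZ
    local_axis_orth latK_polar latK_quad polar_vw Dt Lv Lw.

Local Notation D := local_lattice.
Local Notation JX := (extIdeal polyC (extIdeal (toloc p) I)).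
Local Notation fractional := (fractional D).
Hypothesis eg : dual_basis e g.

Let egX := dual_basis_ext (phi := polyC) eg.

Lemma fractional_const z : fractional (fun=> inQ _ z).
Proof.
have [c nc Lc] := latK_const z.
by exists (toK c) => //; exists c.
Qed.

Lemma fractional_ideal z :
    (forall k, JX (polar qKX (tens polyC 1 (tens (toloc p) 1 (b k))) z)) ->
  fractional (fun n => if n then inQ _ z else 0).
Proof.
move=> /in_ideal_denominator[c nc [y Iy e1]]; exists (toK c); first by exists c.
exists (fun n => if n then y else 0); last by rewrite subr0.
case; last by rewrite scaler0 locX0.
by rewrite -e1 inQZ.
Qed.

Let twoK : 2%:R * inv2 {poly K} = 1 := inv2P halfKX2.

Lemma scal_inv2 : scal D (fun=> inv2 {poly K}).
Proof. by rewrite (inv2E halfKX2) -polyLocC; apply: scalK_poly. Qed.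

Lemma eichler_words (u : bool) (z : 'I_m -> bool -> HKX) :
    (forall i, fractional (z i)) ->
  words D fractional (fun n => eichler hqKX (inv2 {poly K})
    [seq (local_axis (i, u), z i n) | i <- enum 'I_m]).
Proof.
move=> Fz; exact: (eichler_mem hqKXP (D := D) twoK scal_inv2 u (enum_uniq 'I_m) Fz).
Qed.

Lemma elementary_words h : elementary qKX setT h -> words D fractional (fun=> h).
Proof.
case=> [[al [al' [_ adj ->]]]|[be [be' [_ adj ->]]]].
  apply: words_eq (@eichler_words true (fun i _ => inQ _ (al' (ext_dual polyC (g i)))) _).
    by move=> n y; apply: (eichler_alpha qKXP egX adj).
  by move=> i; apply: fractional_const.
apply: words_eq (@eichler_words false (fun i _ => inQ _ (be' (tens polyC 1 (e i)))) _).
  by move=> n y; apply: (eichler_beta qKXP egX adj).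
by move=> i; apply: fractional_const.
Qed.

Lemma elementary_ideal_words h : elementary qKX JX h ->
  words D fractional (fun n => if n then h else id).
Proof.
have JXI : is_ideal JX := @extIdeal_ideal _ _ _ _.
case=> [[al [al' [Jal adj ->]]]|[be [be' [Jbe adj ->]]]].
  apply: words_eq (@eichler_words true
    (fun i n => if n then inQ _ (al' (ext_dual polyC (g i))) else 0) _).
    case=> y; first exact: (eichler_alpha qKXP egX adj).
    by apply: (eichler_trivial hqKXP) => _ /mapP[i _ ->].
  move=> i; apply: fractional_ideal => k; rewrite polarC adj.
  by apply: linear_ideal_mul (Jal _) => // c y y'; rewrite dual_funD dual_funZ.
apply: words_eq (@eichler_words false
    (fun i n => if n then inQ _ (be' (tens polyC 1 (e i))) else 0) _).
  case=> y; first exact: (eichler_beta qKXP egX adj).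
  by apply: (eichler_trivial hqKXP) => _ /mapP[i _ ->].
move=> i; apply: fractional_ideal => k; rewrite polarC adj.
apply: (linear_ideal_mul (N := dualmod (polyExt (locExt p P)))
  (g := fun h => dual_fun h (tens polyC 1 (e i)))) (Jbe _) => // c y y'.
Qed.

Lemma words_inverse (h h' : bool -> HKX -> HKX) : words D fractional h ->
  (forall n, cancel (h n) (h' n)) -> (forall n, cancel (h' n) (h n)) ->
  words D fractional h'.
Proof.
move=> Wh hK h'K.
have [h1 [Wh1 _ h1K]] := words_inv hqKXP (fun _ H => H) (fractionalN (D := D)) Wh.
by apply: words_eq Wh1 => n y; rewrite -[h1 n y](hK n) h1K.
Qed.

Lemma EO_words h : EO qKX setT h -> words D fractional (fun=> h).
Proof.
elim=> {h} [|h|h1 h2 _ IH1 _ IH2|h h' _ IH hK h'K].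
- exact: words1.
- exact: elementary_words.
- exact: (words_comp IH1 IH2).
- exact: (words_inverse IH).
Qed.

Lemma EO_ideal_words h : EO qKX JX h -> words D fractional (fun n => if n then h else id).
Proof.
elim=> {h} [|h|h1 h2 _ IH1 _ IH2|h h' _ IH hK h'K].
- by apply: words_eq (words1 D _) => -[].
- exact: elementary_ideal_words.
- by apply: words_eq (words_comp IH1 IH2) => -[].
- by apply: (words_inverse IH) => -[].
Qed.

(** With (g, g) and (h, 1) the pair (g h g^-1, 1) is a word too. *)
Lemma EO_rel_words h : EO_rel qKX JX h ->
  words D fractional (fun n => if n then h else id).
Proof.
elim=> {h} [|h [g1 [g1' [h1 [Eg g1K g1'K Eh ->]]]]|h1 h2 _ IH1 _ IH2|h h' _ IH hK h'K].
- by apply: words_eq (words1 D _) => -[].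
- have W1 := EO_words Eg.
  have W1' : words D fractional (fun=> g1') by apply: (words_inverse W1) => _.
  apply: words_eq (words_comp (words_comp W1 (EO_ideal_words Eh)) W1') => -[] y //=.
  exact: g1'K.
- by apply: words_eq (words_comp IH1 IH2) => -[].
- by apply: (words_inverse IH) => -[].
Qed.

Lemma quad_lam u : hqKX (lam u) = polyLoc (hqX u).
Proof.
rewrite (quad_half hqKXP halfKX2) (polar_lam _ qP).
rewrite (quad_half (hyp_quadratic _ qXP) halfX2 u) -polyLocC.
exact/esym/rmorphM.
Qed.

Lemma lam_transv u1 u2 u : lam (transv hqX u1 u2 u) =
  transv hqKX (lam u1) (lam u2) (lam u).
Proof.
rewrite /transv lamD lamD lamN !lamZ !(polar_lam _ qP) quad_lam.
by congr (_ + (_ - _ *: _)); rewrite rmorphD rmorphM.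
Qed.

Lemma common_axis_denominator : exists2 c, ~ p c & forall d, exists2 u : HX,
  (exists y, u = inP _ y) \/ (exists h, u = inF _ h) & toK c *: local_axis d = lam u.
Proof.
apply: prime_common => [d c c' [u Hu e1]|d].
  exists (c'%:P *: u); last by rewrite lamZ -e1 polyLocC scalerA toKM.
  case: Hu => [[y ->]|[h ->]]; [left; exists (c'%:P *: y) | right; exists (c'%:P *: h)].
    by rewrite inPZ.
  by rewrite inFZ.
have [c nc [u e1]] := hyp_denominator (local_axis d).
exists c => //; move: e1; rewrite /local_axis; case: ifP => _ e1.
  exists (inP _ u.1.2); first by left; exists u.1.2.
  rewrite lam_inP -inPZ; congr inP.
  exact: (congr1 (fun u : HKX => u.1.2) e1).
exists (inF _ u.2); first by right; exists u.2.
rewrite lam_inF -inFZ; congr inF.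
exact: (congr1 (fun u : HKX => u.2) e1).
Qed.

Let hqXP : is_quadratic hqX := hyp_quadratic _ qXP.
Let twoX : 2%:R * inv2 {poly R} = 1 := inv2P halfX2.

Lemma transv_EO J u y : is_ideal J ->
    (exists y, u = inP _ y) \/ (exists h, u = inF _ h) ->
  (forall y', J (polar qX y y')) -> EO qX J (transv hqX u (inQ _ y)).
Proof.
move=> JI Hu Jy; apply: generated_mem.
have JN c : J c -> J (- c) by apply: is_idealN.
case: Hu => [[y' ->]|[h ->]].
  exact: transv_elementary_P.
exact: transv_elementary_F.
Qed.

Section Lift.
Variables c s' : R.
Hypothesis axis_c : forall d, exists2 u : HX,
  (exists y, u = inP _ y) \/ (exists h, u = inF _ h) & toK c *: local_axis d = lam u.

(** As c clears the denominators of the axes, T_(e_d, c s' y) is the image of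
    the transvection of c e_d and s' y, which is defined over R[X]. The quotient
    of the two members of a pair stays in the relative group, as the latter is
    normal. *)
Lemma words_lift h : words D (smult D (toK (c * s'))) h ->
  exists h1 h2 k2 : HX -> HX,
    [/\ EO qX setT h1, EO qX setT h2, cancel h2 k2, cancel k2 h2 &
        EO_rel qX IX (h1 \o k2) /\
     [/\ forall u, lam (h1 u) = h true (lam u),
         forall u, lam (h2 u) = h false (lam u),
         forall u, exists u0, h1 u = u + s'%:P *: u0 &
         forall u, exists u0, h2 u = u + s'%:P *: u0]].
Proof.
elim=> {h} [|d z0 h [z [y yE Iy] ->] _ [h1 [h2 [k2 [E1 E2 hK kH [Er [l1 l2 c1 c2]]]]]]].
  exists id, id, id; split=> //; try exact: generated_id.
  split; first exact: generated_id.
  by split=> // u; exists 0; rewrite scaler0 addr0.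
have [u Hu e1] := axis_c d.
pose T n := transv hqX u (inQ _ (s'%:P *: y n)).
pose T' n := transv hqX u (- inQ _ (s'%:P *: y n)).
have uu : hqX u = 0.
  by case: Hu => [[y' ->]|[f' ->]]; rewrite (quad_inP, quad_inF).
have uz y' : polar hqX u (inQ _ y') = 0.
  by rewrite polarC polar_inQ; case: Hu => [[y'' ->]|[f' ->]] /=; rewrite (polar0r qXP).
have TK n : cancel (T n) (T' n) by apply: transvNK.
have T'K n : cancel (T' n) (T n) by apply: transvK.
have ET n : EO qX setT (T n) by apply: transv_EO.
have lT n u0 : lam (T n u0) = ptransv d (fun n => toK (c * s') *: z n) n (lam u0).
  rewrite /T lam_transv -e1 /ptransv (transvZ hqKXP) lam_inQ locXZ polyLocC yE.
  by rewrite inQZ scalerA -toKM.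
have cT n u0 : exists u1, T n u0 = u0 + s'%:P *: u1.
  exists (polar hqX u u0 *: inQ _ (y n) - (polar hqX (inQ _ (y n)) u0 +
    s'%:P * hqX (inQ _ (y n)) * polar hqX u u0) *: u).
  rewrite /T /transv inQZ (polarZl hqXP) (quadZ hqXP).
  by lincomb.
exists (T true \o h1), (T false \o h2), (k2 \o T' false); split.
- exact: (generated_comp (ET _) E1).
- exact: (generated_comp (ET _) E2).
- by move=> u0 /=; rewrite TK hK.
- by move=> u0 /=; rewrite kH T'K.
split.
  have -> : (T true \o h1) \o (k2 \o T' false) =
      (T true \o (h1 \o k2) \o T' true) \o (T true \o T' false).
    by apply/funext => u0 /=; rewrite TK.
  apply: generated_comp; first exact: EO_rel_conj.
  apply: EO_sub_rel.
  have -> : T true \o T' false = transv hqX u (inQ _ (s'%:P *: (y true - y false))).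
    rewrite scalerBr inQD inQN; apply/funext => u0; apply: transvD => //.
    by rewrite (polarNr hqXP) uz oppr0.
  apply: transv_EO => // y'; rewrite (polarZl qXP); apply: IXM; exact: in_ideal_polar.
- split.
  + by move=> u0 /=; rewrite lT l1.
  + by move=> u0 /=; rewrite lT l2.
  + move=> u0 /=; have [v1 ->] := c1 u0; have [v2 ->] := cT true (u0 + s'%:P *: v1).
    by exists (v1 + v2); rewrite scalerDr addrA.
  + move=> u0 /=; have [v1 ->] := c2 u0; have [v2 ->] := cT false (u0 + s'%:P *: v1).
    by exists (v1 + v2); rewrite scalerDr addrA.
Qed.

End Lift.

Let halfK2 : 2%:R * toloc p half = 1.
Proof.
have <- : toloc p 2%:R = 2%:R by apply: rmorph_nat.
transitivity (toloc p (2%:R * half)); first by apply/esym/rmorphM.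
by rewrite half2; apply: rmorph1.
Qed.

(** The word of the pair (alK, 1) lifts after a sufficiently divisible shift.
    The lift and the quotient of the two substitutions in al have the same image
    and are congruent modulo s', hence coincide. *)
Lemma local_shift s' (al al' : HX -> HX) (alK : HKX -> HKX) :
    ~ p s' -> (forall c, toloc p c = 0 -> s' * c = 0) ->
    linear al -> linear al' -> cancel al al' -> cancel al' al ->
    (forall u, alK (lam u) = lam (al u)) -> EO_rel qKX JX alK ->
  exists2 t1, ~ p t1 & forall t0 c,
    EO_rel qX IX (twist FX (t0 + t1 * c) al \o twist FX t0 al').
Proof.
move=> ns' s'0 lal lal' alKK alKK' alE Eal.
have [c nc axis_c] := common_axis_denominator.
have denC d : den D d -> exists2 t2, from_base t2 & d = t2%:P.
  by move=> [t0 nt0 ->]; exists (toloc p t0) => //; exists t0.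
have PM t0 t1 : from_base t0 -> from_base t1 -> from_base (t0 * t1).
  by move=> [c0 ->] [c1 ->]; exists (c0 * c1); rewrite rmorphM.
have PD t0 t1 : from_base t0 -> from_base t1 -> from_base (t0 + t1).
  by move=> [c0 ->] [c1 ->]; exists (c0 + c1); rewrite rmorphD.
have [h' [Wh' hK h'K shift]] := words_shift hqKXP halfK2 denC PM PD local_axisC
  latK_frescale latK_shift (EO_rel_words Eal).
have [|tK [t1 nt1 /polyC_inj ->] {}shift] := shift (toK (c * s')).
  by exists (c * s') => //; apply: prime_complM.
(* The factor s' makes the two substitutions in al congruent modulo s'. *)
exists (t1 * s'); first exact: prime_complM.
move=> t0 c0.
have Pt0 : from_base (toloc p t0) by exists t0.
have Pc0 : from_base (toloc p (s' * c0)) by exists (s' * c0).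
have [h1 [h2 [k2 [_ _ h2K k2K [Er [l1 l2 c1 c2]]]]]] :=
  words_lift axis_c (shift _ _ Pt0 Pc0).
have tE : toloc p t0 + toloc p t1 * toloc p (s' * c0) = toloc p (t0 + t1 * s' * c0).
  by rewrite -rmorphM -rmorphD mulrA.
have lalK : linear alK := words_linear hqKXP true (EO_rel_words Eal).
have lh' : linear (h' true) := words_linear hqKXP true Wh'.
have h'E u : h' true (lam u) = lam (al' u).
  by rewrite -[u in LHS]alKK' -alE; apply: (hK true).
have h1E : h1 = twist FX (t0 + t1 * s' * c0) al \o twist FX t0 al'.
  apply/funext => u; have [u1 e1] := c1 u.
  have [u2 e2] : exists u2, (twist FX (t0 + t1 * s' * c0) al \o twist FX t0 al') u =
      u + s'%:P *: u2.
    have e0 : t0 + t1 * s' * c0 = t0 + s' * (t1 * c0) by ring.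
    have [u2 e2] := twist_shift FX t0 s' (t1 * c0) al (twist FX t0 al' u).
    exists u2; rewrite /= e0 e2; congr (_ + _).
    rewrite -[LHS]/((twist FX t0 al \o twist FX t0 al') u) -twist_comp //.
    have -> : al \o al' = id by apply/funext => u0 /=.
    by rewrite twist_id.
  apply: (lam_inj (s' := s') (z := u1 - u2)) => //.
    by rewrite e1 e2 scalerBr -addrA [s'%:P *: u2 + _]addrC subrK.
  rewrite l1 tE; apply: etrans (@lam_twist _ al alK _ lal lalK alE).
  exact: (congr1 (twist FK _ alK) (@lam_twist t0 al' (h' true) u lal' lh' h'E)).
have h2E : h2 = id.
  apply/funext => u; have [u2 e2] := c2 u.
  apply: (lam_inj ns' s'0 e2); rewrite l2 /=.
  have -> : h' false = id by apply/funext => u1; apply: hK.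
  by rewrite !twist_id.
have k2E : k2 = id by apply/funext => u; have := k2K u; rewrite h2E.
by rewrite -h1E; have := Er; rewrite k2E.
Qed.

End Lattice.

End Axes.

End LocalLattice.

(** * The local-global principle *)

Lemma exists_maximal_ideal (A : comNzRingType) (J : set A) : is_ideal J -> ~ J 1 ->
  exists2 M : set A, is_maximal_ideal M & forall x, J x -> M x.
Proof.
move=> [J0 JD JM] J1.
pose good (X : set A) := [/\ is_ideal X, ~ X 1 & forall x, J x -> X x].
(* The union of the empty chain is the empty set, which is therefore admitted. *)
have chain F : (F `<=` [set X | X = set0 \/ good X] -> total_on F subset ->
    [set X | X = set0 \/ good X] (\bigcup_(X in F) X))%classic.
  move=> Fgood Ftot; have [[X0 [FX0 X0good]]|noX] := pselect (exists X, F X /\ good X).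
    have FI X x : F X -> X x -> good X.
      by move=> FX Xx; case: (Fgood X FX) => // X_0; move: Xx; rewrite X_0.
    have [[X0_0 _ _] _ JX0] := X0good.
    right; split.
    - split.
      + by exists X0.
      + move=> x y [X FX Xx] [Y FY Yy]; have [[_ XD _] _ _] := FI X x FX Xx.
        have [[_ YD _] _ _] := FI Y y FY Yy.
        have [XY|YX] := Ftot X Y FX FY.
          by exists Y => //; apply: YD => //; apply: XY.
        by exists X => //; apply: XD => //; apply: YX.
      + move=> a x [X FX Xx]; have [[_ _ XM] _ _] := FI X x FX Xx.
        by exists X => //; apply: XM.
    - by move=> [X FX X1]; have [_ + _] := FI X 1 FX X1; apply.
    - by move=> x Jx; exists X0 => //; apply: JX0.
  left; apply/seteqP; split=> // x [X FX Xx]; case: (Fgood X FX) => [X_0|Xgood].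
    by move: Xx; rewrite X_0.
  by case: noX; exists X.
have [M [Mgood Mmax]] := Zorn_bigcup chain.
case: Mgood => [M0|[MI M1 JM']].
  case: (Mmax J); last by right; split.
  rewrite M0; split=> // H; exact: (H 0 J0).
exists M => //; split=> // X XI X1 MX.
have [//|XM] := pselect (X = M); case: (Mmax X).
  split=> // XsubM; apply: XM; apply/seteqP; split=> // x; exact: MX.
by right; split=> // x Jx; apply: MX; apply: JM'.
Qed.

(** The kernel is generated by finitely many elements, each of which is killed by
    an element outside of p. *)
Lemma localization_annihilator (R : comNzRingType) (p : primeIdeal R) :
  noetherian R -> exists2 s, ~ p s & forall c, toloc p c = 0 -> s * c = 0.
Proof.
move=> noeth.
have [|l lE] := noeth (fun c => toloc p c = 0).
  split=> [|x y x0 y0|a x x0]; first exact: rmorph0.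
    by have -> : toloc p (x + y) = toloc p x + toloc p y; [apply: rmorphD|rewrite x0 y0 addr0].
  by have -> : toloc p (a * x) = toloc p a * toloc p x; [apply: rmorphM|rewrite x0 mulr0].
have [i s t e|i|s ns sl] := @prime_common _ p 'I_(size l) (fun i s => s * nth 0 l i = 0).
- by rewrite -mulrA e mulr0.
- have : toloc p (nth 0 l i) = 0.
    by apply/lE; apply: submod_span_mem; rewrite mem_nth.
  by move=> /toloc_eq0[s ns e]; exists s.
exists s => // c /lE; move: c.
apply: (submod_span_min (N := R^o) (T := fun c => s * c = 0)) => [|x y x0 y0|a x xl].
- by rewrite mulr0.
- by rewrite mulrDr x0 y0 addr0.
have [i lti <-] : exists2 i, (i < size l)%N & nth 0 l i = x.
  by exists (index x l); rewrite ?index_mem // nth_index.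
by rewrite -[LHS]/(s * (a * _)) mulrCA (sl (Ordinal lti)) mulr0.
Qed.

Lemma free_dual_basis (A : comNzRingType) (N : lmodType A) m :
  (exists f : {linear N -> 'rV[A]_m}, bijective f) ->
  exists (e : 'I_m -> N) (g : 'I_m -> dualmod N), dual_basis e g /\
    forall i j, dual_fun (g i) (e j) = (i == j)%:R.
Proof.
move=> [f [f' fK f'K]].
have g_lin i : scalar (fun x => f x 0 i) by move=> a x y; rewrite linearP !mxE.
pose g i : dualmod N := HB.pack (fun x => f x 0 i : A)
  (GRing.isLinear.Build _ _ _ _ (fun x => f x 0 i : A) (g_lin i)).
exists (fun i => f' (delta_mx 0 i)), g; split.
  move=> x; apply: (can_inj fK); rewrite linear_sum {1}[f x]row_sum_delta.
  by apply: eq_bigr => i _; rewrite linearZ f'K.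
by move=> i j; rewrite -[LHS]/(f (f' (delta_mx 0 j)) 0 i) f'K mxE.
Qed.

(** The form is not degenerate, so the first coordinate in a basis is the product
    with some vector; the pair is that vector with the first basis vector. *)
Lemma unimodular_pair (A : comNzRingType) (N : lmodType A) (q : N -> A) n r
    (a b : 'I_r -> N) : is_quadratic q -> (1 <= n)%N -> adjoint_basis q a b ->
  (exists f : {linear N -> 'rV[A]_n}, bijective f) ->
  exists v w, polar q v w = 1.
Proof.
case: n => // n qP _ ab [f [f' fK f'K]].
exists (f' (delta_mx 0 ord0)), (\sum_k f (a k) 0 ord0 *: b k).
set v := f' _; transitivity (f v 0 ord0); last by rewrite f'K mxE !eqxx.
rewrite (polar_sumr qP) {2}[v]ab linear_sum summxE; apply: eq_bigr => k _.
by rewrite (polarZr qP) linearZ mxE polarC mulrC.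
Qed.

Section AtZero.
Variables (R : comNzRingType) (Q P : lmodType R) (q : Q -> R).
Hypothesis qP : is_quadratic q.
Variables (r : nat) (a b : 'I_r -> Q) (s : nat) (x : 'I_s -> P) (f : 'I_s -> dualmod P).
Hypothesis ab : adjoint_basis q a b.
Hypothesis xf : dual_basis x f.

Lemma ev0ZD (N : lmodType R) c (y z : polyExt N) :
  ev0 (c *: y + z) = c.[0] *: ev0 y + ev0 z.
Proof. exact: ev0_semilin. Qed.
Lemma ev00 (N : lmodType R) : ev0 (0 : polyExt N) = 0.
Proof. by have := ev0ZD (-1) (0 : polyExt N) 0; rewrite scaler0 addr0 hornerN hornerC scaleN1r addNr. Qed.
Lemma ev0_tens1 (N : lmodType R) (y : N) : ev0 (tens polyC 1 y) = y.
Proof.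
rewrite /ev0 ext_lift_tens; first by rewrite rmorph1 scale1r.
by move=> c z z' /=; rewrite /horner_eval hornerC.
Qed.

(** This is how the hypothesis at X = 0 is used: the constant terms of the
    coordinates can be read off hyp_ev0. *)
Lemma frescale0_ev0 u v : hyp_ev0 u = hyp_ev0 v ->
  frescale (FX qP ab xf) 0 u = frescale (FX qP ab xf) 0 v.
Proof.
have qXP := ext_quad_quadratic polyC qP.
move=> uv; have eQ := congr1 (fun y => y.1.1) uv; have eP := congr1 (fun y => y.1.2) uv.
apply: eq_bigr => i _; congr (_ *: _); rewrite !rescale_0; congr polyC.
case: i => [i|[i|i]] /=.
- have E y : (polar (ext_quad polyC q) (tens polyC 1 (b i)) y).[0] = polar q (b i) (ev0 y).
    move: y; apply: ext_ind => [c y z ey ez||y].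
    + by rewrite (polarDr qXP) (polarZr qXP) hornerD hornerM ey ez ev0ZD !(polarE qP).
    + by rewrite (polar0r qXP) ev00 (polar0r qP) horner0.
    + by rewrite (ext_polar_tens _ qP) ev0_tens1 !mul1r hornerC.
  by rewrite !E; congr polar; apply: eQ.
- have E y : (dual_fun (ext_dual polyC (f i)) y).[0] = dual_fun (f i) (ev0 y).
    move: y; apply: ext_ind => [c y z ey ez||y].
    + by rewrite dual_funD dual_funZ hornerD hornerM ey ez ev0ZD dual_funD dual_funZ.
    + by rewrite dual_fun0 ev00 dual_fun0 horner0.
    + by rewrite ext_dual_tens ev0_tens1 mul1r hornerC.
  by rewrite !E; congr dual_fun; apply: eP.
- have E (h : dualmod (polyExt P)) :
    (dual_fun h (tens polyC 1 (x i))).[0] = dual_fun (dual_ev0 h) (x i) by [].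
  by rewrite !E -[dual_ev0 u.2]/(hyp_ev0 u).2 uv.
Qed.

End AtZero.

Lemma comp_insert (T : Type) (g k h h' : T -> T) : h' \o h = id ->
  g \o k = (g \o h') \o (h \o k).
Proof.
by move=> hK; apply/funext => u /=; rewrite -[h' _]/((h' \o h) (k u)) hK.
Qed.

Theorem theorem4p4 (R : comNzRingType) (two_unit : exists h : R, 2%:R * h = 1)
    (R_noetherian : noetherian R) (I : set R) (I_ideal : is_ideal I)
    (n m : nat) (n_ge1 : (1 <= n)%N) (m_ge2 : (2 <= m)%N)
    (Q : lmodType R) (q : Q -> R) (Q_quad : quadratic_space q)
    (Q_rank : has_rank Q n)
    (P : lmodType R) (P_fg : finitely_generated P) (P_proj : projective P)
    (P_rank : has_rank P m)
    (alpha : hyp (polyExt Q) (polyExt P) -> hyp (polyExt Q) (polyExt P))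
    (alpha_orth : orthogonal_group (ext_quad polyC q) alpha)
    (alpha_0 : forall u, hyp_ev0 (alpha u) = hyp_ev0 u)
    (alpha_loc : forall (M : set R) (M_max : is_maximal_ideal M),
       let p := PrimeIdeal (maximal_prime M_max) in
       exists alpha_M : hyp (polyExt (locExt p Q)) (polyExt (locExt p P)) ->
                        hyp (polyExt (locExt p Q)) (polyExt (locExt p P)),
         (forall u, alpha_M (hyp_locX p u) = hyp_locX p (alpha u)) /\
         EO_rel (ext_quad polyC (ext_quad (toloc p) q))
           (extIdeal polyC (extIdeal (toloc p) I)) alpha_M) :
  EO_rel (ext_quad polyC q) (extIdeal polyC I) alpha.
Proof.
have [half half2] := two_unit; have [_ _ qP _] := Q_quad.
have [r [a [b ab]]] := exists_adjoint_basis Q_quad.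
have [s [x [f xf]]] := exists_dual_basis P_fg P_proj.
have [alin [alpha' aK a'K] _] := alpha_orth.
have a'lin : linear alpha'.
  by move=> c u v; apply: (can_inj aK); rewrite alin !a'K.
pose F := FX qP ab xf.
(* Quillen's ideal: it measures how far apart two values of the variable may be
   for alpha to change by an element of the relative group only. *)
pose J : set R := fun t => forall t0 c, EO_rel (ext_quad polyC q) (extIdeal polyC I)
  (twist F (t0 + t * c) alpha \o twist F t0 alpha').
have tw_inv t : twist F t alpha' \o twist F t alpha = id.
  apply/funext => u; rewrite -[LHS]twist_comp //.
  have -> : alpha' \o alpha = id by apply/funext => v; apply: aK.
  exact: twist_id.
have tw_inv' t : twist F t alpha \o twist F t alpha' = id.
  apply/funext => u; rewrite -[LHS]twist_comp //.
  have -> : alpha \o alpha' = id by apply/funext => v; apply: a'K.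
  exact: twist_id.
have JI : is_ideal J.
  split=> [t0 c|t1 t2 J1 J2 t0 c|t1 t2 J2 t0 c].
  - by rewrite mul0r addr0 tw_inv'; apply: generated_id.
  - have -> : t0 + (t1 + t2) * c = t0 + t2 * c + t1 * c by ring.
    (* Telescoping through the intermediate value t'. *)
    set t' := t0 + t2 * c.
    rewrite (comp_insert _ _ (tw_inv t')).
    exact: (generated_comp (J1 t' c) (J2 t0 c)).
  - have -> : t0 + t1 * t2 * c = t0 + t2 * (t1 * c) by ring.
    exact: (J2 t0 (t1 * c)).
have [J1|nJ1] := pselect (J 1); last first.
  have [M M_max JM] := exists_maximal_ideal JI nJ1.
  pose p := PrimeIdeal (maximal_prime M_max).
  have [alpha_M [aM Ea]] := alpha_loc M M_max.
  have [e [g [eg ge]]] := free_dual_basis (P_rank p).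
  have [v [w vw]] := unimodular_pair (ext_quad_quadratic (toloc p) qP) n_ge1
    (adjoint_basis_ext qP ab) (Q_rank p).
  have [s' ns' s'0] := localization_annihilator p R_noetherian.
  have [t Dt [Lv Lw]] := common_vw (p := p) qP I ab xf v w.
  have [t1 nt1 H] := local_shift qP half2 ab xf m_ge2 ge vw Dt Lv Lw eg ns' s'0
    alin a'lin aK a'K aM Ea.
  by case: nt1; apply: JM.
have tw0 : twist F 0 alpha = id.
  apply/funext => u; rewrite -[RHS](twist_id F 0); apply: eq_bigr => i _.
  by congr (_ *: _); apply: frescale0_ev0.
have tw0' : twist F 0 alpha' = id by rewrite -(tw_inv' 0) tw0.
have -> : alpha = twist F (0 + 1 * 1) alpha \o twist F 0 alpha'.
  rewrite tw0' mulr1 add0r; apply/funext => u; exact/esym/twist_1.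
exact: J1.
Qed.
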